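(* Let $(\mathbf{x}_i^T,y_i)$, $i=1,\dots,n$, be i.i.d. observations with $y_i=\mathbf{x}_i^T\boldsymbol\beta_0+u_i$, where $\boldsymbol\beta_0\in\mathbb{R}^p$, $\mathbf{x}_i\in\mathbb{R}^p$ has distribution $G_0$, $u_i$ has distribution $F_0$, and $u_i$ is independent of $\mathbf{x}_i$. Let $\rho_0,\rho_1$ be bounded $\rho$-functions with $\rho_1\le\rho_0$, and let $0<b<1$. Assume: [B1] $\rho_0$ and $\rho_1$ are twice continuously differentiable and eventually constant. [B2] $P_{G_0}(\mathbf{x}^T\boldsymbol\beta=0)<1-b$ for all non-zero $\boldsymbol\beta\in\mathbb{R}^p$. [B3] $F_0$ has an even continuous density $f_0$ that is a monotone decreasing function of $|u|$ and a strictly decreasing function of $|u|$ in a neighborhood of $0$. Let $r,q,t,\varsigma>0$, let $\gamma_n,\lambda_n,\iota_n>0$, and let $\hat{\boldsymbol\beta}_1,\hat{\boldsymbol\beta}_2$ be consistent initial estimates of $\boldsymbol\beta_0$. Let $\hat{\boldsymbol\beta}_{PS}$, $\hat{\boldsymbol\beta}_B$, $\hat{\boldsymbol\beta}_A$ be the S-Bridge, MM-Bridge and adaptive MM-Bridge estimators. Then, as $n\to\infty$: (i) if $\gamma_n=o(n)$, then $\hat{\boldsymbol\beta}_{PS}\to\boldsymbol\beta_0$ almost surely; (ii) if $\lambda_n=o(n)$, then $\hat{\boldsymbol\beta}_{B}\to\boldsymbol\beta_0$ almost surely; (iii) if $\iota_n=o(n)$, then $\hat{\boldsymbol\beta}_{A}\to\boldsymbol\beta_0$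 almost surely.
   Context: The dimension $p$ is fixed. A bounded $\rho$-function is a function $\rho:\mathbb{R}\to[0,1]$ such that $\rho(u)$ is a nondecreasing function of $|u|$, $\rho(0)=0$, $\lim_{u\to\infty}\rho(u)=1$, and $\rho$ is strictly increasing on $\{u>0:\rho(u)<1\}$. ''Eventually constant'' means constant for all sufficiently large $|u|$. Residuals: $r_i(\boldsymbol\beta)=y_i-\mathbf{x}_i^T\boldsymbol\beta$, $\mathbf{r}(\boldsymbol\beta)=(r_1(\boldsymbol\beta),\dots,r_n(\boldsymbol\beta))$. M-estimate of scale: for $\mathbf{u}=(u_1,\dots,u_n)$, $s_n(\mathbf{u})=\inf\{s>0:\frac1n\sum_{i=1}^n\rho_0(u_i/s)\le b\}$. S-Bridge estimator: $\hat{\boldsymbol\beta}_{PS}=\arg\min_{\boldsymbol\beta\in\mathbb{R}^p} n\,s_n^2(\mathbf{r}(\boldsymbol\beta))+\gamma_n\sum_{j=1}^p|\beta_j|^r$. MM-Bridge estimator: $\hat{\boldsymbol\beta}_B=\arg\min_{\boldsymbol\beta\in\mathbb{R}^p}\sum_{i=1}^n\rho_1\big(r_i(\boldsymbol\beta)/s_n(\mathbf{r}(\hat{\boldsymbol\beta}_1))\big)+\lambda_n\sum_{j=1}^p|\beta_j|^q$. Adaptive MM-Bridge estimator: $\hat{\boldsymbol\beta}_A=\arg\min_{\boldsymbol\beta\in\mathbb{R}^p}\sum_{i=1}^n\rho_1\big(r_i(\boldsymbol\beta)/s_n(\mathbf{r}(\hat{\boldsymbol\beta}_1))\big)+\iota_n\sum_{j=1}^p|\beta_j|^t/|\hat\beta_{2,j}|^{\varsigma}$;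 if $\hat\beta_{2,j}=0$ then $\hat\beta_{A,j}=0$ (the $j$-th penalty term is read as $0$ when $\beta_j=0$ and $+\infty$ otherwise). In all three definitions, if the model contains an intercept, the intercept is not penalized. All estimators, including $\hat{\boldsymbol\beta}_1,\hat{\boldsymbol\beta}_2$, are computed from the sample of size $n$. *)

(* Defs.v *)
From HB Require Import structures.
From mathcomp Require Import all_boot all_order all_algebra.
From mathcomp Require Import all_classical all_reals all_analysis.

Set Implicit Arguments.
Unset Strict Implicit.
Unset Printing Implicit Defensive.

Import Order.TTheory GRing.Theory Num.Theory.
Import numFieldNormedType.Exports.

Local Open Scope classical_set_scope.
Local Open Scope ring_scope.

(* [R^p] with its Borel sigma-algebra; convertible to ['cV[R]_p]. *)
Notation borel_cV R p := (g_sigma_algebraType (@open 'cV[R]_p)).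

Section rho_functions.
Context {R : realType}.
Implicit Type rho : R -> R.

Definition bounded_rho rho : Prop :=
  [/\ forall u, 0 <= rho u <= 1,
      forall u v, `|u| <= `|v| -> rho u <= rho v,
      rho 0 = 0,
      rho u @[u --> +oo] --> (1 : R) &
      forall u v, 0 < u -> rho u < 1 -> rho v < 1 -> u < v -> rho u < rho v].

Definition twice_cont_diff rho : Prop :=
  [/\ forall u, derivable rho u 1,
      forall u, derivable (derive1 rho) u 1 &
      continuous (derive1 (derive1 rho))].

Definition eventually_constant rho : Prop :=
  exists c M : R, forall u, M <= `|u| -> rho u = c.

End rho_functions.

Section probability_notions.
Context {R : realType} {d : measure_display} {T : measurableType d}.
Variable P : probability T R.
Local Open Scope ereal_scope.

Definition has_law d' (S : measurableType d') (X : T -> S)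
    (Q : probability S R) : Prop :=
  forall A, measurable A -> P (X @^-1` A) = Q A.

Definition independent2 d1 d2 (S1 : measurableType d1) (S2 : measurableType d2)
    (X : T -> S1) (Y : T -> S2) : Prop :=
  forall A B, measurable A -> measurable B ->
    P (X @^-1` A `&` Y @^-1` B) = P (X @^-1` A) * P (Y @^-1` B).

(* Mutual independence: the product rule over every finite set [I] of
   indices. *)
Definition mutually_independent d' (S : measurableType d')
    (Z : nat -> T -> S) : Prop :=
  forall (I : seq nat) (A : nat -> set S), uniq I ->
    (forall i, measurable (A i)) ->
    P (\bigcap_(i in [set` I]) (Z i @^-1` A i)) =
    \prod_(i <- I) P (Z i @^-1` A i).

Definition identically_distributed d' (S : measurableType d')
    (Z : nat -> T -> S) : Prop :=
  forall i j A, measurable A -> P (Z i @^-1` A) = P (Z j @^-1` A).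

Definition iid d' (S : measurableType d') (Z : nat -> T -> S) : Prop :=
  mutually_independent Z /\ identically_distributed Z.

End probability_notions.

Definition has_density {R : realType}
    (F : probability R R) (f : R -> R) : Prop :=
  (forall u, 0 <= f u) /\
  forall A, measurable A ->
    F A = (\int[lebesgue_measure]_(u in A) (f u)%:E)%E.

Definition argmin {disp : Order.disp_t} {V : Type} {D : porderType disp}
    (f : V -> D) (v : V) : Prop := forall v', (f v <= f v')%O.

Section linear_model.
Context {R : realType} {p : nat}.
Implicit Types (beta : 'cV[R]_p) (rho : R -> R).

Definition dot (v beta : 'cV[R]_p) : R := (v^T *m beta) 0 0.

(* A sample of size [n]: the pairs (x_i, y_i), i < n. *)
Definition sample (n : nat) : Type := 'I_n -> 'cV[R]_p * R.

Definition estimator : Type := forall n, sample n -> 'cV[R]_p.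

Definition residuals n (z : sample n) beta : 'cV[R]_n :=
  \col_i ((z i).2 - dot (z i).1 beta).

Definition m_scale rho (b : R) n (u : 'cV[R]_n) : R :=
  inf [set s : R | 0 < s /\ n%:R^-1 * \sum_(i < n) rho (u i 0 / s) <= b].

(* [ic] is [Some j] when the model has an intercept, sitting in the [j]-th
   coordinate, and [None] otherwise; the intercept is not penalized. *)
Definition bridge_penalty (ic : option 'I_p) (q : R) beta : R :=
  \sum_(j < p | Some j != ic) `|beta j 0| `^ q.

(* When [w = 0], the coordinate [c] is constrained to vanish, whence the value
   [+oo] if it does not. *)
Definition adaptive_term (t vs w c : R) : \bar R :=
  if w == 0 then (if c == 0 then 0%:E else +oo%E)
  else (`|c| `^ t / `|w| `^ vs)%:E.

Definition adaptive_penalty (ic : option 'I_p) (t vs : R) (beta2 : 'cV[R]_p)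
    beta : \bar R :=
  (\sum_(j < p | Some j != ic)
     adaptive_term t vs (beta2 j 0%R) (beta j 0%R))%E.

(* At a degenerate scale [s = 0] the quotients are 0, since [_ / 0 = 0]. *)
Definition m_loss rho (s : R) n (z : sample n) beta : R :=
  \sum_(i < n) rho (residuals z beta i 0 / s).

Definition s_bridge_obj (ic : option 'I_p) rho0 (b r gamma : R) n
    (z : sample n) beta : R :=
  n%:R * m_scale rho0 b (residuals z beta) ^+ 2
  + gamma * bridge_penalty ic r beta.

Definition mm_bridge_obj (ic : option 'I_p) rho0 rho1 (b q lambda : R) n
    (z : sample n) (beta1 : 'cV[R]_p) beta : R :=
  m_loss rho1 (m_scale rho0 b (residuals z beta1)) z beta
  + lambda * bridge_penalty ic q beta.

Definition adaptive_mm_bridge_obj (ic : option 'I_p) rho0 rho1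
    (b t vs iota : R) n (z : sample n) (beta1 beta2 : 'cV[R]_p) beta : \bar R :=
  ((m_loss rho1 (m_scale rho0 b (residuals z beta1)) z beta)%:E
   + iota%:E * adaptive_penalty ic t vs beta2 beta)%E.

End linear_model.

Arguments sample : clear implicits.
Arguments estimator : clear implicits.

(* The first [n] observations. *)
Definition first_obs {R : realType} {p : nat} {T : Type}
    (x : nat -> T -> 'cV[R]_p) (y : nat -> T -> R) (n : nat) (w : T) :
    sample R p n :=
  fun i => (x i w, y i w).

Arguments first_obs {R p T} x y n w.

(* [est n] is not assumed measurable: [{ae P, _}] only asks that the
   non-convergence set be included in a measurable set of probability 0. *)
Definition strongly_consistent {R : realType} {p : nat} {d : measure_display}
    {T : measurableType d} (P : probability T R)
    (x : nat -> T -> 'cV[R]_p) (y : nat -> T -> R)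
    (est : estimator R p) (beta0 : 'cV[R]_p) : Prop :=
  {ae P, forall w, est n (first_obs x y n w) @[n --> \oo] --> beta0}.

(* Main.v *)
Require Import Defs.
From HB Require Import structures.
From mathcomp Require Import all_boot all_order all_algebra.
From mathcomp Require Import all_classical all_reals all_analysis.
From mathcomp Require Import measurable_realfun ring lra.

Set Implicit Arguments.
Unset Strict Implicit.
Unset Printing Implicit Defensive.

Import Order.TTheory GRing.Theory Num.Theory.
Import numFieldNormedType.Exports.

Local Open Scope classical_set_scope.
Local Open Scope ring_scope.

(* Write h = beta - beta0, so that the residuals are u_i - x_i'h, and let s0 be
   the scale with E rho0(u / s0) = b. The heart of the matter is a lower bound
   that is uniform in h: for rho in {rho0, rho1} and eps > 0 there is e > 0 such
   that almost surely, for large n, the mean of rho((u_i - x_i'h) / (s0 + e))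
   is at least E rho(u / s0) + e whenever |h| >= eps. Parametrizing h = theta/a
   with |theta| = 1 and 0 <= a <= 1/eps compactifies the problem: at a > 0 the
   bound comes from Anderson's inequality for the unimodal density of u, at the
   points at infinity a = 0 from P(x'theta <> 0) > b, and the law of large
   numbers is applied to finitely many bounded minorants. Each penalty being
   o(n), an estimator that stays eps away from beta0 would then have a larger
   objective than beta0. *)

(** No moments of x or u are assumed, so nothing dominates the residuals when h is unbounded; only
    [0,1]-valued functions are averaged, and a second-moment strong law is enough for them. The
    scale moves together with the mean, from s0 to s0 + e, for two reasons. For the S-estimator, a
    mean above b at s0 + e forces the M-scale up to at least s0 + e, away from its value near s0 at
    beta0. For the MM-estimators, the random scale eventually lies below s0 + e, and rho(r / s) is
    non-increasing in s, so a bound at the fixed scale s0 + e transfers to it. At infinity the mean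
    only has to beat E rho(u / s0), which is at most b for both losses: with equality for rho0, and
    through rho1 <= rho0 for rho1. The exceptional null sets do not depend on h, so the bounds can
    be evaluated path by path at the estimators, whose measurability is not assumed. The scale s0
    exists and is isolated because u is almost surely non-zero, which makes s -> E rho0(u / s)
    strictly decreasing wherever it is below 1. *)

(** * Strict comparison of integrals, and integrals of [0,1]-valued functions *)

Section strict_monotonicity.
Context {R : realType} {d : measure_display} {T : measurableType d}.
Variable mu : {measure set T -> \bar R}.

Lemma ae_eq_Rintegral (f g : T -> R) : mu.-integrable setT (EFin \o f) ->
  mu.-integrable setT (EFin \o g) ->
  (forall w, f w <= g w) -> \int[mu]_w f w = \int[mu]_w g w ->
  {ae mu, forall w, f w = g w}.
Proof.
move=> intf intg fg fgE.
have /measurable_EFinP mf := measurable_int _ intf.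
have /measurable_EFinP mg := measurable_int _ intg.
have mgf : measurable_fun setT (EFin \o (g \- f)).
  by apply/measurable_EFinP; exact: measurable_funB.
have : ae_eq mu setT (EFin \o (g \- f)) (cst 0%E).
  apply/ae_eq_integral_abs => //.
  transitivity (\int[mu]_w ((g w)%:E - (f w)%:E))%E.
    apply: eq_integral => w _ /=.
    by rewrite ger0_norm ?subr_ge0// EFinB.
  rewrite integralB_EFin//.
  rewrite -[X in (X - _)%E]fineK ?integrable_fin_num//.
  rewrite -[X in (_ - X)%E]fineK ?integrable_fin_num//.
  rewrite -EFinB -/(Rintegral mu setT f) -/(Rintegral mu setT g).
  by rewrite fgE subrr.
apply: filterS => w /(_ I)/= [/eqP].
by rewrite subr_eq0 => /eqP ->.
Qed.

(** Equal integrals would force [f = g] almost everywhere, which a set [A] of positive measure rules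
    out. *)
Lemma lt_Rintegral (f g : T -> R) (A : set T) :
  mu.-integrable setT (EFin \o f) -> mu.-integrable setT (EFin \o g) ->
  (forall w, f w <= g w) -> measurable A -> (0 < mu A)%E ->
  (forall w, A w -> f w < g w) -> \int[mu]_w f w < \int[mu]_w g w.
Proof.
move=> intf intg fg mA PA fgA; rewrite lt_neqAle le_Rintegral// andbT.
apply/eqP => /(ae_eq_Rintegral intf intg fg) [N [mN PN fgN]].
move: PA; rewrite lt_neqAle => /andP[/eqP + _]; apply.
apply/esym/eqP; rewrite -measure_le0 -PN; apply: le_measure; rewrite ?inE//.
by move=> w Aw; apply: fgN => /= fgw; move: (fgA _ Aw); rewrite fgw ltxx.
Qed.

End strict_monotonicity.

Section unit_valued_integrals.
Context {R : realType} {d : measure_display} {T : measurableType d}.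
Variable P : probability T R.
Implicit Types f g : T -> R.

Lemma integrable_unit f : measurable_fun setT f ->
  (forall w, 0 <= f w <= 1) -> P.-integrable setT (EFin \o f).
Proof.
move=> mf f01; apply: measurable_bounded_integrable => //.
  by rewrite -ge0_fin_numE// fin_num_measure.
exists 1; split => // M M1 w _ /=.
by have /andP[f0 f1] := f01 w; rewrite ger0_norm// (le_trans f1)// ltW.
Qed.

Lemma Rintegral_unit f : measurable_fun setT f ->
  (forall w, 0 <= f w <= 1) -> 0 <= \int[P]_w f w <= 1.
Proof.
move=> mf f01; apply/andP; split.
  by apply: Rintegral_ge0 => w _; case/andP: (f01 w).
have -> : 1 = \int[P]_w (1 : R).
  by rewrite Rintegral_cst//= [X in fine X](probability_setT P) mul1r.
apply: le_Rintegral => //; first exact: integrable_unit.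
  by apply: integrable_unit => // w; rewrite ler01 lexx.
by move=> w _; case/andP: (f01 w).
Qed.

Lemma EFin_Rintegral_unit f : measurable_fun setT f ->
  (forall w, 0 <= f w <= 1) ->
  (\int[P]_w f w)%:E = (\int[P]_w (f w)%:E)%E.
Proof.
move=> mf f01; rewrite fineK//.
by apply: integrable_fin_num => //; exact: integrable_unit.
Qed.

Lemma le_Rintegral_unit f g : measurable_fun setT f -> measurable_fun setT g ->
  (forall w, 0 <= f w <= 1) -> (forall w, 0 <= g w <= 1) ->
  (forall w, f w <= g w) -> \int[P]_w f w <= \int[P]_w g w.
Proof.
by move=> mf mg f01 g01 fg; apply: le_Rintegral => //; exact: integrable_unit.
Qed.

Lemma bounded_convergence (f_ : nat -> T -> R) g :
  (forall n, measurable_fun setT (f_ n)) -> measurable_fun setT g ->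
  (forall n w, 0 <= f_ n w <= 1) ->
  (forall w, f_ n w @[n --> \oo] --> g w) ->
  \int[P]_w f_ n w @[n --> \oo] --> \int[P]_w g w.
Proof.
move=> mf mg f01 fg.
have [|||||ig _] := @dominated_convergence _ _ _ P setT measurableT
  (fun n w => (f_ n w)%:E) (EFin \o g) (cst 1%E).
- by move=> n; exact/measurable_EFinP.
- exact/measurable_EFinP.
- by apply/aeW => w _; apply/fine_cvgP; split; [exact: nearW|exact: fg].
- by apply: (@integrable_unit (cst 1)) => // w; rewrite ler01 lexx.
- apply/aeW => w n _ /=; rewrite lee_fin.
  by have /andP[f0 f1] := f01 n w; rewrite ger0_norm.
rewrite -EFin_Rintegral_unit//; first by move=> /fine_cvgP[_].
move=> w; apply/andP; split.
  by rewrite -(cvg_lim _ (fg w))//; apply: limr_ge; [exact: cvgP (fg w)|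
    apply: nearW => n; case/andP: (f01 n w)].
by rewrite -(cvg_lim _ (fg w))//; apply: limr_le; [exact: cvgP (fg w)|
  apply: nearW => n; case/andP: (f01 n w)].
Qed.

Lemma lt_Rintegral_unit f g (A : set T) : measurable_fun setT f ->
  measurable_fun setT g ->
  (forall w, 0 <= f w <= 1) -> (forall w, 0 <= g w <= 1) ->
  (forall w, f w <= g w) -> measurable A -> (0 < P A)%E ->
  (forall w, A w -> f w < g w) -> \int[P]_w f w < \int[P]_w g w.
Proof.
move=> mf mg f01 g01 fg; apply: lt_Rintegral => //; exact: integrable_unit.
Qed.

End unit_valued_integrals.

(** * Independence and iterated integrals *)

Section independence.
Context {R : realType} {d : measure_display} {T : measurableType d}.
Variable P : probability T R.
Context d1 d2 (S1 : measurableType d1) (S2 : measurableType d2).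

(** The joint law and the product of the marginal laws agree on rectangles, hence everywhere;
    Tonelli then integrates [X] out first, with [Y] frozen. This plays the part of conditioning on
    [Y]. *)
Lemma integral_independent2 (X : {RV P >-> S1}) (Y : {RV P >-> S2})
    (f : S1 * S2 -> R) : independent2 P X Y -> measurable_fun setT f ->
  (forall z, 0 <= f z <= 1) ->
  \int[P]_w f (X w, Y w) = \int[P]_w \int[P]_v f (X v, Y w).
Proof.
move=> XY mf f01.
have mXY : measurable_fun setT (fun w => (X w, Y w)).
  by apply: measurable_fun_pair.
pose XYm : {RV P >-> (S1 * S2)%type} :=
  HB.pack (fun w => (X w, Y w)) (isMeasurableFun.Build _ _ _ _ _ mXY).
have mf' : measurable_fun setT (EFin \o f) by exact/measurable_EFinP.
have f0 z : (0 <= (f z)%:E)%E by rewrite lee_fin; case/andP: (f01 z).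
have jointE A : measurable A ->
    (distribution P X \x distribution P Y)%E A = distribution P XYm A.
  apply: product_measure_unique => A1 A2 mA1 mA2.
  by rewrite /= /distribution /pushforward/= -XY.
congr fine.
transitivity (\int[distribution P XYm]_z (f z)%:E)%E.
  by rewrite ge0_integral_distribution.
transitivity (\int[distribution P X \x distribution P Y]_z (f z)%:E)%E.
  by apply: eq_measure_integral => A mA _; exact/esym/jointE.
rewrite (fubini_tonelli2 (m1 := distribution P X) (m2 := distribution P Y))//.
rewrite ge0_integral_distribution//; last 2 first.
- exact: measurable_fun_fubini_tonelli_G.
- by move=> y; apply: integral_ge0.
apply: eq_integral => w _ /=.
rewrite EFin_Rintegral_unit//; last first.
  apply: measurableT_comp => //.
  by apply: measurable_fun_pair => //; exact: measurable_cst.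
rewrite /fubini_G ge0_integral_distribution//.
by apply/measurable_EFinP; exact: measurableT_comp.
Qed.

End independence.

(** * Strong law for bounded uncorrelated variables *)

Section strong_law.
Context {R : realType} {d : measure_display} {T : measurableType d}.
Variable P : probability T R.
Implicit Types f g : T -> R.

Definition bounded_measurable f : Prop :=
  measurable_fun setT f /\ exists M, forall w, `|f w| <= M.

Lemma integrable_bounded f : bounded_measurable f ->
  P.-integrable setT (EFin \o f).
Proof.
move=> [mf [M fM]]; apply: measurable_bounded_integrable => //.
  by rewrite -ge0_fin_numE// fin_num_measure.
exists M; split; rewrite ?num_real// => N MN w _.
by apply: (le_trans (fM w)); exact: ltW.
Qed.

Lemma bounded_measurable_cst (c : R) : bounded_measurable (fun=> c).
Proof. by split=> //; exists `|c|. Qed.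

Lemma bounded_measurableD f g : bounded_measurable f ->
  bounded_measurable g -> bounded_measurable (fun w => f w + g w).
Proof.
move=> [mf [M fM]] [mg [N gN]]; split; first exact: measurable_funD.
by exists (M + N) => w; rewrite (le_trans (ler_normD _ _))// lerD.
Qed.

Lemma bounded_measurableM f g : bounded_measurable f ->
  bounded_measurable g -> bounded_measurable (fun w => f w * g w).
Proof.
move=> [mf [M fM]] [mg [N gN]]; split; first exact: measurable_funM.
by exists (M * N) => w; rewrite normrM ler_pM.
Qed.

Lemma bounded_measurable_sum (I : Type) (s : seq I) (F : I -> T -> R) :
  (forall i, bounded_measurable (F i)) ->
  bounded_measurable (fun w => \sum_(i <- s) F i w).
Proof.
move=> bF; elim: s => [|i s IHs].
  by under eq_fun do rewrite big_nil; exact: bounded_measurable_cst.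
by under eq_fun do rewrite big_cons; exact: bounded_measurableD.
Qed.

Lemma RintegralD_bounded f g : bounded_measurable f -> bounded_measurable g ->
  \int[P]_w (f w + g w) = \int[P]_w f w + \int[P]_w g w.
Proof. by move=> bf bg; rewrite RintegralD//; exact: integrable_bounded. Qed.

Lemma RintegralMl_bounded (c : R) f : bounded_measurable f ->
  \int[P]_w (c * f w) = c * \int[P]_w f w.
Proof. by move=> bf; rewrite RintegralZl//; exact: integrable_bounded. Qed.

Lemma Rintegral_sum_bounded (I : Type) (s : seq I) (F : I -> T -> R) :
  (forall i, bounded_measurable (F i)) ->
  \int[P]_w (\sum_(i <- s) F i w) = \sum_(i <- s) \int[P]_w F i w.
Proof.
move=> bF; elim: s => [|i s IHs].
  rewrite big_nil; under eq_Rintegral do rewrite big_nil.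
  by rewrite Rintegral_cst// mul0r.
rewrite big_cons; under eq_Rintegral do rewrite big_cons.
by rewrite RintegralD_bounded ?IHs//; exact: bounded_measurable_sum.
Qed.

Lemma Rintegral_cst_prob (c : R) : \int[P]_w c = c.
Proof. by rewrite Rintegral_cst//= [X in fine X](probability_setT P) mulr1. Qed.

(** Orthogonality removes the cross terms, and each square contributes at most 1. *)
Lemma second_moment_sum (D : nat -> T -> R) n :
  (forall i, bounded_measurable (D i)) ->
  (forall i w, `|D i w| <= 1) ->
  (forall i j, i != j -> \int[P]_w (D i w * D j w) = 0) ->
  \int[P]_w ((\sum_(i < n) D i w) ^+ 2) <= n%:R.
Proof.
move=> bD D1 DD; elim: n => [|n IHn].
  under eq_Rintegral do rewrite big_ord0 expr0n.
  by rewrite Rintegral_cst_prob.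
have bS : bounded_measurable (fun w => \sum_(i < n) D i w).
  exact: bounded_measurable_sum.
have -> : \int[P]_w ((\sum_(i < n.+1) D i w) ^+ 2) =
    \int[P]_w ((\sum_(i < n) D i w) ^+ 2) +
    (2 * (\sum_(i < n) \int[P]_w (D i w * D n w)) + \int[P]_w (D n w * D n w)).
  rewrite -Rintegral_sum_bounded; last by move=> i; exact: bounded_measurableM.
  rewrite -RintegralMl_bounded; last first.
    by apply: bounded_measurable_sum => i; exact: bounded_measurableM.
  rewrite -RintegralD_bounded; [|apply: bounded_measurableM|]; last 3 first.
  - exact: bounded_measurable_cst.
  - by apply: bounded_measurable_sum => i; exact: bounded_measurableM.
  - exact: bounded_measurableM.
  rewrite -RintegralD_bounded; last 2 first.
  - by under eq_fun do rewrite expr2; exact: bounded_measurableM.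
  - apply: bounded_measurableD; last exact: bounded_measurableM.
    apply: bounded_measurableM; first exact: bounded_measurable_cst.
    by apply: bounded_measurable_sum => i; exact: bounded_measurableM.
  apply: eq_Rintegral => w _; rewrite big_ord_recr/= -mulr_suml; ring.
rewrite big1 ?mulr0 ?add0r => [|i _]; last first.
  by apply: DD; rewrite neq_ltn ltn_ord.
rewrite -natr1 lerD// -[leRHS](Rintegral_cst_prob 1).
apply: le_Rintegral => //.
- exact/integrable_bounded/bounded_measurableM.
- exact/integrable_bounded/bounded_measurable_cst.
- by move=> w _; rewrite (le_trans (ler_norm _))// normrM mulr_ile1.
Qed.

Lemma sum_inv_sqr_le2 (n : nat) : \sum_(k < n) ((k.+1)%:R ^+ 2)^-1 <= 2 :> R.
Proof.
(* The induction needs this sharper bound, since 1/(m+1)^2 <= 1/m - 1/(m+1). *)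
suff : \sum_(k < n.+1) ((k.+1)%:R ^+ 2)^-1 <= 2 - n.+1%:R^-1 :> R.
  move=> h; apply: le_trans (le_trans h _); last by rewrite gerBl invr_ge0.
  by rewrite big_ord_recr/= lerDl invr_ge0 exprn_ge0.
elim: n => [|n IHn]; first by rewrite big_ord1 expr1n invr1; lra.
rewrite big_ord_recr/= (le_trans (lerD IHn (lexx _)))//.
have n0 : 0 < n.+1%:R :> R by rewrite ltr0n.
rewrite -(natr1 n.+1); set m : R := n.+1%:R.
have m0 : 0 < m by [].
have m1 : 0 < m + 1 by rewrite ltr_wpDr.
have -> : 2 - m^-1 + ((m + 1) ^+ 2)^-1 = 2 - (m + 1)^-1 - (m * (m + 1) ^+ 2)^-1.
  by field; rewrite !gt_eqF.
by rewrite gerBl invr_ge0 mulr_ge0// ?exprn_ge0// ltW.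
Qed.

Lemma sqrt_floor (n : nat) : exists k, (k ^ 2 <= n < k.+1 ^ 2)%N.
Proof.
elim: n => [|n [k /andP[kn nk]]]; first by exists 0%N.
have [nk'|nk'] := ltnP n.+1 (k.+1 ^ 2).
  by exists k; rewrite nk' (leq_trans kn).
exists k.+1; rewrite nk'/= (leq_ltn_trans nk)// ltn_sqr//.
Qed.

(** A sequence that moves by at most 1 per step drifts by at most 2(k+1) between (k+1)^2 and the
    next square, which is negligible against n >= (k+1)^2. *)
Lemma cvg_sqr_subseq (S : nat -> R) :
  (forall n, `|S n.+1 - S n| <= 1) ->
  (S (k.+1 ^ 2)%N / (k.+1 ^ 2)%:R) @[k --> \oo] --> (0 : R) ->
  (n%:R^-1 * S n) @[n --> \oo] --> (0 : R).
Proof.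
move=> S1 Sk.
have SD m k : `|S (m + k)%N - S m| <= k%:R.
  elim: k => [|k IHk]; first by rewrite addn0 subrr normr0.
  rewrite addnS (le_trans (ler_distD (S (m + k)%N) _ _))// -natr1 addrC.
  by rewrite lerD.
apply/cvgrPdist_lt => e e0.
have e2 : 0 < e / 2 by rewrite divr_gt0.
have [K1 _ HK1] := (@cvgrPdist_lt _ _ _ _ _ _ _).1 Sk _ e2.
have [K2 HK2] : exists K : nat, forall k, (K <= k)%N -> 2 / k.+1%:R < e / 2.
  exists (Num.truncn (4 / e)).+1 => k Kk.
  rewrite ltr_pdivrMr ?ltr0n//.
  have : 4 / e < k.+1%:R.
    rewrite (lt_le_trans (truncnS_gt _))// ler_nat (leq_trans Kk)//.
  rewrite ltr_pdivrMr// => h; rewrite mulrAC ltr_pdivlMr//; lra.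
exists ((K1 + K2).+1 ^ 2)%N => // n /= Kn.
have [[|k] /andP[kn nk]] := sqrt_floor n.
  by move: nk Kn; rewrite exp1n ltnS leqn0 => /eqP->; rewrite leqn0 expn_eq0.
have Kk : (K1 + K2 <= k)%N.
  by have := leq_ltn_trans Kn nk; rewrite ltn_sqr !ltnS.
have n0 : (0 < n)%N by rewrite (leq_trans _ kn)// expn_gt0.
have n0R : 0 < n%:R :> R by rewrite ltr0n.
have k0R : 0 < (k.+1)%:R :> R by rewrite ltr0n.
have k20R : 0 < (k.+1 ^ 2)%:R :> R by rewrite natrX exprn_gt0.
have := HK1 k (leq_trans (leq_addr _ _) Kk) => /=.
rewrite !sub0r !normrN => h1.
have h2 := HK2 k (leq_trans (leq_addl _ _) Kk).
have h3 : `|S n| <= `|S (k.+1 ^ 2)%N| + 2 * k.+1%:R.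
  have : `|S n - S (k.+1 ^ 2)%N| <= 2 * k.+1%:R.
    rewrite -{1}(subnKC kn) (le_trans (SD _ _))// -natrM ler_nat.
    by rewrite leq_subLR -ltnS (leq_trans nk)// -addn1 sqrnD muln1 exp1n addnAC
      addn1.
  by move=> h; rewrite -[S n](subrK (S (k.+1 ^ 2)%N)) addrC
    (le_trans (ler_normD _ _))// lerD.
rewrite normrM normfV (ger0_norm (ltW n0R)) mulrC ltr_pdivrMr//.
have kn' : (k.+1 ^ 2)%:R <= n%:R :> R by rewrite ler_nat.
apply: (lt_le_trans _ (ler_wpM2l (ltW e0) kn')).
apply: (le_lt_trans h3).
move: h1; rewrite normrM normfV (gtr0_norm k20R) ltr_pdivrMr// => h1.
have h4 : 2 * k.+1%:R < e / 2 * (k.+1 ^ 2)%:R.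
  by move: h2; rewrite ltr_pdivrMr// natrX expr2 mulrA ltr_pM2r.
by rewrite (splitr e) [ltRHS]mulrDl ltrD.
Qed.

(* The averages over the first k^2 terms have summable second moments, and the
   boundedness of [Y] controls the averages in between. *)
Lemma strong_law_unit (Y : nat -> T -> R) (mu : R) :
  (forall i, measurable_fun setT (Y i)) ->
  (forall i w, 0 <= Y i w <= 1) ->
  (forall i, \int[P]_w Y i w = mu) ->
  (forall i j, i != j -> \int[P]_w (Y i w * Y j w) = mu ^+ 2) ->
  {ae P, forall w, (n%:R^-1 * \sum_(i < n) Y i w) @[n --> \oo] --> mu}.
Proof.
move=> mY Y01 EY EYY.
pose D i w := Y i w + - mu.
have bY i : bounded_measurable (Y i).
  by split=> //; exists 1 => w; case/andP: (Y01 i w) => ? ?; rewrite ger0_norm.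
have bD i : bounded_measurable (D i).
  by apply: bounded_measurableD => //; exact: bounded_measurable_cst.
have mu01 : 0 <= mu <= 1 by rewrite -(EY 0%N) Rintegral_unit.
have D1 i w : `|D i w| <= 1.
  rewrite /D ler_norml; have /andP[? ?] := Y01 i w; case/andP: mu01 => ? ?.
  by apply/andP; split; lra.
have DD i j : i != j -> \int[P]_w (D i w * D j w) = 0.
  move=> ij; under eq_Rintegral do rewrite /D mulrDl !mulrDr.
  have bcst := bounded_measurable_cst.
  have bM := bounded_measurableM; have bA := bounded_measurableD.
  have bYc : bounded_measurable (fun w => Y i w * - mu) by apply: bM => //.
  rewrite RintegralD_bounded; [|by apply: bA => //; apply: bM|].
  - rewrite RintegralD_bounded//; last by apply: bM.
    rewrite EYY// RintegralD_bounded; [|by apply: bM|by apply: bM].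
    under [X in _ + X + _]eq_Rintegral do rewrite mulrC.
    by rewrite !RintegralMl_bounded// !EY Rintegral_cst_prob; ring.
  - by apply: bA; apply: bM.
pose S w n := \sum_(i < n) D i w.
pose f k w := (S w (k.+1 ^ 2)%N / (k.+1 ^ 2)%:R) ^+ 2.
have bf k : bounded_measurable (f k).
  rewrite /f; under eq_fun do rewrite expr2.
  by apply: bounded_measurableM; apply: bounded_measurableM;
    [exact: bounded_measurable_sum|exact: bounded_measurable_cst|
     exact: bounded_measurable_sum|exact: bounded_measurable_cst].
have mf k : measurable_fun setT (EFin \o f k).
  by apply/measurable_EFinP; case: (bf k).
have f0 k w : (0 <= (f k w)%:E)%E by rewrite lee_fin sqr_ge0.
have If k : (\int[P]_w (f k w)%:E <= (((k.+1)%:R ^+ 2)^-1)%:E)%E.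
  rewrite -(@fineK _ (\int[P]_w (f k w)%:E)%E); last first.
    by apply: integrable_fin_num => //; exact: integrable_bounded.
  rewrite lee_fin -/(Rintegral P setT (f k)).
  have -> : \int[P]_w f k w =
      \int[P]_w (((k.+1 ^ 2)%:R ^+ 2)^-1 * (\sum_(i < k.+1 ^ 2) D i w) ^+ 2).
    by apply: eq_Rintegral => w _; rewrite /f expr_div_n mulrC.
  rewrite RintegralMl_bounded; last first.
    under eq_fun do rewrite expr2.
    by apply: bounded_measurableM; exact: bounded_measurable_sum.
  apply: le_trans (ler_wpM2l _ (second_moment_sum _ bD D1 DD)) _.
    by rewrite invr_ge0 exprn_ge0.
  have k0 : 0 < (k.+1)%:R :> R by rewrite ltr0n.
  by rewrite natrX le_eqVlt; apply/orP; left; apply/eqP; field; rewrite gt_eqF.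
(* Integrating term by term bounds the expected series by 2, so the series is finite almost surely
   and its terms tend to 0; this stands in for Chebyshev and Borel-Cantelli. *)
have : (\int[P]_w (\sum_(0 <= k <oo) (f k w)%:E) < +oo)%E.
  rewrite (integral_nneseries _ measurableT)//.
  apply: (@le_lt_trans _ _ (2%:E)); last exact: ltry.
  apply: lime_le.
    by apply: is_cvg_nneseries => n _ _; exact: integral_ge0.
  apply: nearW => n; rewrite big_mkord.
  apply: (@le_trans _ _ (\sum_(i < n) (((i.+1)%:R ^+ 2)^-1)%:E)%E).
    by apply: lee_sum => i _; exact: If.
  by rewrite sumEFin lee_fin sum_inv_sqr_le2.
move=> Ifin.
have : P.-integrable setT (fun w => \sum_(0 <= k <oo) (f k w)%:E)%E.
  apply/integrableP; split.
    by apply: (@ge0_emeasurable_sum _ _ _ setT (fun k w => (f k w)%:E) xpredT)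
      => // k _; exact: mf.
  rewrite (eq_integral (fun w => \sum_(0 <= k <oo) (f k w)%:E)%E)// => w _.
  by rewrite gee0_abs//; apply: nneseries_ge0 => k _ _; exact: f0.
move=> /(integrable_ae measurableT).
apply: filterS => w /(_ I) sfin.
have fcvg : cvgn (series (fun k => f k w)).
  apply: nondecreasing_is_cvgn.
    by apply: nondecreasing_series => n _ _; rewrite sqr_ge0.
  exists (fine (\sum_(0 <= k <oo) (f k w)%:E)%E) => _ [n _ <-].
  rewrite -lee_fin fineK// -sumEFin; exact: nneseries_lim_ge.
have f_0 := cvg_series_cvg_0 fcvg.
have SD : (n%:R^-1 * S w n) @[n --> \oo] --> (0 : R).
  apply: cvg_sqr_subseq.
    by move=> n; rewrite /S big_ord_recr/= addrAC subrr add0r.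
  apply/cvgr0Pnorm_lt => e e0.
  have e2 : 0 < e ^+ 2 by rewrite exprn_gt0.
  move/cvgr0Pnorm_lt : f_0 => /(_ _ e2); apply: filterS => k.
  rewrite /f ger0_norm ?sqr_ge0// -real_normK ?num_real//.
  by rewrite ltr_pXn2r ?nnegrE// ltW.
have -> : mu = 0 + mu by rewrite add0r.
apply: cvg_trans (cvgD SD (cvg_cst mu)); apply: near_eq_cvg.
exists 1%N => // n /= n0.
rewrite /= fctE.
have -> : S w n = \sum_(i < n) Y i w - mu * n%:R.
  by rewrite /S big_split/= sumr_const card_ord mulNrn mulr_natr.
have n0R : n%:R != 0 :> R by rewrite pnatr_eq0 -lt0n.
by rewrite /cst mulrBr [n%:R^-1 * (mu * _)]mulrC mulfK// subrK.
Qed.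

End strong_law.

(** * Densities and a strict form of Anderson's inequality *)

Section densities.
Context {R : realType}.
Implicit Types (F : probability (measurableTypeR R) R) (f g : R -> R).
Local Notation leb := (@lebesgue_measure R).

(* [has_density] over the measurable type that carries [lebesgue_measure]. *)
Definition lebesgue_density F f : Prop :=
  (forall u, 0 <= f u) /\
  forall A, measurable A -> F A = (\int[leb]_(u in A) (f u)%:E)%E.

Lemma lebesgue_density_integrable F f : lebesgue_density F f ->
  measurable_fun setT f ->
  leb.-integrable setT (EFin \o f).
Proof.
move=> [f0 Ff] mf; apply/integrableP; split; first exact/measurable_EFinP.
rewrite [X in (X < _)%E](_ : _ = (\int[leb]_u (f u)%:E)%E); last first.
  by apply: eq_integral => x _ /=; rewrite ger0_norm.
by rewrite -Ff// (@le_lt_trans _ _ 1%E) ?ltry// probability_le1.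
Qed.

(** [F] is dominated by Lebesgue measure, and [f] equals its Radon-Nikodym derivative almost
    everywhere because both integrate to [F A] over every measurable [A]. *)
Lemma integral_density F f g : lebesgue_density F f -> measurable_fun setT f ->
  measurable_fun setT g -> (forall u, 0 <= g u <= 1) ->
  (\int[F]_u (g u)%:E = \int[leb]_u (g u * f u)%:E)%E.
Proof.
move=> Ff mf mg g01.
have Fleb : F `<< leb.
  apply/null_content_dominatesP => A mA A0; rewrite Ff.2//.
  apply: null_set_integral => //.
  by apply/measurable_EFinP; exact: (measurable_funTS mf).
rewrite -(Radon_Nikodym_change_of_variables Fleb)//=; last first.
  exact: (integrable_unit F).
apply: ae_eq_integral => //.
- apply: emeasurable_funM; first exact/measurable_EFinP.
  by apply: measurable_int; apply: Radon_Nikodym_integrable.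
- by apply/measurable_EFinP; exact: measurable_funM.
- under [X in ae_eq _ _ _ X]eq_fun do rewrite EFinM.
  apply: ae_eqe_mul2l.
  apply: integral_ae_eq => //.
  + exact: Radon_Nikodym_integrable.
  + exact/measurable_EFinP.
  + by move=> A _ mA; rewrite -Radon_Nikodym_integral//= -(Ff.2 _ mA).
Qed.

Lemma ge0_integral_reflection (c : R) f : measurable_fun setT f ->
  (forall u, 0 <= f u) ->
  (\int[leb]_u (f u)%:E = \int[leb]_u (f (c - u))%:E)%E.
Proof.
move=> mf f0.
have mphi : measurable_fun (setT : set (measurableTypeR R))
    ((fun u => c - u) : measurableTypeR R -> measurableTypeR R).
  have : measurable_fun setT (fun u : R => c - u) by apply: measurable_funB.
  exact.
have := @ge0_integral_pushforward _ _ _ _ R _ mphi leb setT (EFin \o f)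
  measurableT.
rewrite preimage_setT => <-//; last 2 first.
- exact/measurable_EFinP.
- by move=> u _; rewrite lee_fin.
apply: eq_measure_integral => A mA _.
apply: lebesgue_measure_unique => //= _ [[a b]] _ <-.
rewrite /pushforward.
have -> : (fun u => c - u) @^-1` [set` `]a, b] ] = [set` `[c - b, c - a[ ].
  apply/seteqP; split => u /=; rewrite !in_itv/= => /andP[? ?];
    apply/andP; split; lra.
rewrite !lebesgue_measure_itv/= !lte_fin.
rewrite ltrD2l ltrN2; case: ifPn => // _.
by rewrite -!EFinD; congr EFin; ring.
Qed.

(* Anderson's inequality for a strictly unimodal density: twice the difference
   of the two sides is the integral of (g (u - c) - g u) * (f u - f (u - c)),
   by the reflection u -> c - u, and both factors have the same sign. *)
Lemma anderson_strict F f g (c delta eta : R) : lebesgue_density F f ->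
  measurable_fun setT f -> (forall v, f (- v) = f v) ->
  (forall v v', `|v| <= `|v'| -> f v' <= f v) ->
  0 < delta ->
  (forall v v', `|v| < `|v'| -> `|v'| < delta -> f v' < f v) ->
  measurable_fun setT g -> (forall u, 0 <= g u <= 1) ->
  (forall u v, `|u| <= `|v| -> g u <= g v) ->
  0 < eta -> (forall u v, `|u| < eta -> `|u| < `|v| -> g u < g v) ->
  c != 0 -> \int[F]_u g u < \int[F]_u g (u - c).
Proof.
move=> Ff mf fE fdec delta0 fsdec mg g01 ginc eta0 gsinc c0.
have gE u : g (- u) = g u by apply/eqP; rewrite eq_le !ginc ?normrN.
have msub : measurable_fun setT (fun u : R => u - c) by apply: measurable_funB.
have mgc : measurable_fun setT (fun u : R => g (u - c)).
  exact: (measurableT_comp mg msub).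
have mfc : measurable_fun setT (fun u : R => f (u - c)).
  exact: (measurableT_comp mf msub).
have f0 := Ff.1.
have g0 u : 0 <= g u by case/andP: (g01 u).
have fcE u : f (c - u) = f (u - c) by rewrite -fE opprB.
have gcE u : g (c - u) = g (u - c) by rewrite -gE opprB.
have fint := lebesgue_density_integrable Ff mf.
have fcint : leb.-integrable setT (EFin \o (fun u => f (u - c))).
  apply/integrableP; split; first exact/measurable_EFinP.
  have /integrableP[_] := fint.
  rewrite [X in (X < _)%E -> _](_ : _ = (\int[leb]_u (f u)%:E)%E); last first.
    by apply: eq_integral => x _ /=; rewrite ger0_norm.
  rewrite (ge0_integral_reflection c)//; apply: le_lt_trans.
  rewrite le_eqVlt; apply/orP; left; apply/eqP; apply: eq_integral => x _ /=.
  by rewrite ger0_norm// fcE.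
have gint (k : R -> R) : measurable_fun setT k -> (forall u, 0 <= k u <= 1) ->
    forall h, leb.-integrable setT (EFin \o h) ->
    leb.-integrable setT (EFin \o (fun u => k u * h u)).
  move=> mk k01 h ih.
  rewrite (_ : _ \o _ = ((EFin \o h) \* (EFin \o k))%E); last first.
    by apply/funext => u /=; rewrite -EFinM mulrC.
  apply: integrableMl => //.
  exists 1; split => // M M1 w _ /=.
  by have /andP[k0 k1] := k01 w; rewrite ger0_norm// (le_trans k1)// ltW.
rewrite /Rintegral !(integral_density Ff mf)//.
rewrite -/(Rintegral leb setT (fun u => g u * f u)).
rewrite -/(Rintegral leb setT (fun u => g (u - c) * f u)).
set B := Rintegral _ _ _; set A := Rintegral _ _ _.
have g01c u : 0 <= g (u - c) <= 1 by [].
have AE : A = \int[leb]_u (g u * f (u - c)).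
  rewrite /A /Rintegral (ge0_integral_reflection c); last 2 first.
  - exact: measurable_funM.
  - by move=> u; rewrite mulr_ge0.
  congr fine; apply: eq_integral => u _.
  by rewrite fcE addrAC subrr add0r gE.
have BE : B = \int[leb]_u (g (u - c) * f (u - c)).
  rewrite /B /Rintegral (ge0_integral_reflection c); last 2 first.
  - exact: measurable_funM.
  - by move=> u; rewrite mulr_ge0.
  by congr fine; apply: eq_integral => u _; rewrite fcE gcE.
suff : B + B < A + A by lra.
rewrite {2}AE {2}BE /A /B -!RintegralD//; [|exact: gint..].
have pos u : 0 <= (g (u - c) - g u) * (f u - f (u - c)).
  have [h|/ltW h] := leP `|u| `|u - c|.
    by rewrite mulr_ge0// subr_ge0; [exact: ginc|exact: fdec].
  by rewrite mulr_le0// subr_le0; [exact: ginc|exact: fdec].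
(* On []0, e[] both factors are strictly positive: u < |c| / 2 gives |u| < |u - c|, u < eta makes
   [g] strict, and u < delta lies where [f] decreases strictly. *)
pose e := Num.min delta (Num.min eta (`|c| / 2)).
have e0 : 0 < e by rewrite /e !lt_min delta0 eta0 divr_gt0// normr_gt0.
apply: (@lt_Rintegral _ _ _ leb _ _ `]0, e[).
- exact: (integrableD measurableT (gint _ mg g01 _ fint)
    (gint _ mgc g01c _ fcint)).
- exact: (integrableD measurableT (gint _ mgc g01c _ fint)
    (gint _ mg g01 _ fcint)).
- by move=> u; move: (pos u); nra.
- exact: measurable_itv.
- suff lE : leb (`]0, e[%classic : set (measurableTypeR R)) = e%:E.
    by move: e0; rewrite -lte_fin -lE.
  by rewrite lebesgue_measure_itv/= lte_fin e0 oppr0 adde0.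
- move=> u /=; rewrite in_itv/= => /andP[u0 ue].
  have uE : `|u| = u by rewrite gtr0_norm.
  move: ue; rewrite /e !lt_min => /and3P[ud ueta uc].
  have uuc : `|u| < `|u - c|.
    have := lerB_dist c u; rewrite (distrC c) uE; move: uc.
    rewrite ltr_pdivlMr//; lra.
  have gg : g u < g (u - c) by apply: gsinc => //; rewrite uE.
  have ff : f (u - c) < f u.
    have [h|h] := ltP `|u - c| delta; first exact: fsdec.
    (* If u - c leaves the zone of strict decrease, the midpoint of u and delta is still inside it
       and separates the two values of [f]. *)
    have m0 : `|(u + delta) / 2| = (u + delta) / 2.
      by rewrite ger0_norm// divr_ge0// ltW// addr_gt0.
    apply: (@le_lt_trans _ _ (f ((u + delta) / 2))).
      by apply: fdec; rewrite m0 ler_pdivrMr//; lra.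
    by apply: fsdec; rewrite m0 ?uE ?ltr_pdivlMr ?ltr_pdivrMr//; lra.
  by nra.
Qed.

End densities.

Section parametric_integrals.
Context {R : realType} {d : measure_display} {T : measurableType d}.
Variable P : probability T R.
Context d1 d2 (S1 : measurableType d1) (S2 : measurableType d2).

Lemma measurable_Rintegral_unit (X : {RV P >-> S1}) (f : S1 * S2 -> R) :
  measurable_fun setT f -> (forall z, 0 <= f z <= 1) ->
  measurable_fun setT (fun y => \int[P]_w f (X w, y)).
Proof.
move=> mf f01; apply/measurable_EFinP.
rewrite (_ : _ \o _ = fubini_G (distribution P X) (EFin \o f)); last first.
  apply/funext => y; rewrite /comp EFin_Rintegral_unit//; last first.
    apply: measurableT_comp => //.
    by apply: measurable_fun_pair => //; exact: measurable_cst.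
  rewrite /fubini_G ge0_integral_distribution//.
  - by apply/measurable_EFinP; exact: measurableT_comp.
  - by move=> z; rewrite lee_fin; case/andP: (f01 (z, y)).
apply: measurable_fun_fubini_tonelli_G; first exact/measurable_EFinP.
by move=> z; rewrite lee_fin; case/andP: (f01 z).
Qed.

End parametric_integrals.

(** * Strong law for bounded functions of i.i.d. observations *)

Section strong_law_iid.
Context {R : realType} {d : measure_display} {T : measurableType d}.
Variable P : probability T R.

Lemma identically_distributed_Rintegral d' (S : measurableType d')
    (Z : nat -> {RV P >-> S}) (k : S -> R) i j :
  identically_distributed P Z -> measurable_fun setT k ->
  (forall z, 0 <= k z <= 1) ->
  \int[P]_w k (Z i w) = \int[P]_w k (Z j w).
Proof.
move=> idZ mk k01; congr fine.
have k0 z : (0 <= (k z)%:E)%E by rewrite lee_fin; case/andP: (k01 z).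
have mk' : measurable_fun setT (EFin \o k) by exact/measurable_EFinP.
rewrite -[LHS](ge0_integral_distribution (Z i) mk')//.
rewrite -[RHS](ge0_integral_distribution (Z j) mk')//.
apply: eq_measure_integral => A mA _; exact: idZ.
Qed.

Lemma mutually_independent2 d' (S : measurableType d') (Z : nat -> T -> S)
  i j : mutually_independent P Z -> i != j -> independent2 P (Z i) (Z j).
Proof.
move=> indZ ij A B mA mB.
have := indZ [:: i; j] (fun l => if l == i then A else B).
rewrite /= inE ij => /(_ isT); rewrite !big_cons big_nil eqxx.
rewrite eq_sym (negbTE ij) mule1 => <-; last by move=> l; case: ifP.
congr (P _); apply/seteqP; split => w.
  move=> [Aw Bw] l /=; rewrite !inE => /orP[/eqP->|/eqP->].
    by rewrite eqxx.
  by rewrite eq_sym (negbTE ij).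
move=> h; split.
  by have := h i; rewrite /= !inE eqxx => /(_ isT).
by have := h j; rewrite /= !inE eqxx orbT (eq_sym j) (negbTE ij) => /(_ isT).
Qed.

Lemma strong_law_iid d' (S : measurableType d') (Z : nat -> {RV P >-> S})
    (k : S -> R) : iid P (fun i => Z i : T -> S) -> measurable_fun setT k ->
  (forall z, 0 <= k z <= 1) ->
  {ae P, forall w, (n%:R^-1 * \sum_(i < n) k (Z i w)) @[n --> \oo] -->
    \int[P]_w k (Z 0%N w)}.
Proof.
move=> [indZ idZ] mk k01.
apply: (@strong_law_unit _ _ _ P (fun i w => k (Z i w))) => // [i|i|i j ij].
- exact: measurableT_comp.
- exact: (identically_distributed_Rintegral i 0%N idZ mk k01).
- have kk01 (z : S * S) : 0 <= k z.1 * k z.2 <= 1.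
    case/andP: (k01 z.1) => ? ?; case/andP: (k01 z.2) => ? ?.
    by rewrite mulr_ge0//= mulr_ile1.
  have mkk : measurable_fun setT (fun z : S * S => k z.1 * k z.2).
    by apply: measurable_funM; exact: measurableT_comp.
  have := integral_independent2 (mutually_independent2 indZ ij) mkk kk01.
  move=> /= ->.
  have E l : \int[P]_w k (Z l w) = \int[P]_w k (Z 0%N w).
    exact: (identically_distributed_Rintegral l 0%N idZ mk k01).
  have bk l : bounded_measurable (fun w => k (Z l w)).
    split; first exact: measurableT_comp.
    by exists 1 => w; case/andP: (k01 (Z l w)) => ? ?; rewrite ger0_norm.
  under eq_Rintegral => w _.
    under eq_Rintegral do rewrite mulrC.
    rewrite RintegralMl_bounded// E mulrC.
    over.
  by rewrite RintegralMl_bounded// E expr2.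
Qed.

End strong_law_iid.

(** * Linear forms and norms on R^p *)

Section measurability_cV.
Context {R : realType} {p : nat}.

Lemma measurable_coord (j : 'I_p) :
  measurable_fun setT (fun v : borel_cV R p => (v : 'cV[R]_p) j 0).
Proof.
apply: (measurability _ (RGenOInfty.measurableE R)) => _ [_ [a ->] <-].
rewrite setTI; apply: sub_sigma_algebra => /=.
apply: open_comp; last exact: interval_open.
by move=> v _; exact: coord_continuous.
Qed.

Lemma dotE (v beta : 'cV[R]_p) : dot v beta = \sum_j v j 0 * beta j 0.
Proof. by rewrite /dot mxE; apply: eq_bigr => j _; rewrite mxE. Qed.

Lemma measurable_dot (beta : 'cV[R]_p) :
  measurable_fun setT (fun v : borel_cV R p => dot v beta).
Proof.
under eq_fun do rewrite dotE.
apply: measurable_sum => j; apply: measurable_funM => //.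
exact: measurable_coord.
Qed.

(** The norm of matrices is the sup norm; this is its dual, so it bounds linear forms with constant
    1. *)
Definition norm1 (v : 'cV[R]_p) : R := \sum_j `|v j 0|.

Lemma norm1_ge0 v : 0 <= norm1 v.
Proof. exact: sumr_ge0. Qed.

Lemma measurable_norm1 : measurable_fun setT (norm1 : borel_cV R p -> R).
Proof.
apply: measurable_sum => j; apply: measurableT_comp => //.
exact: measurable_coord.
Qed.

Lemma ler_dot_norm1 (v beta : 'cV[R]_p) (e : R) :
  (forall j, `|beta j 0| <= e) -> `|dot v beta| <= norm1 v * e.
Proof.
move=> be; rewrite dotE (le_trans (ler_norm_sum _ _ _))// mulr_suml.
by apply: ler_sum => j _; rewrite normrM ler_wpM2l.
Qed.

Lemma dotBr (v a b : 'cV[R]_p) : dot v (a - b) = dot v a - dot v b.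
Proof. by rewrite /dot mulmxBr !mxE. Qed.

Lemma dotZr (v a : 'cV[R]_p) (c : R) : dot v (c *: a) = c * dot v a.
Proof. by rewrite /dot -scalemxAr !mxE. Qed.

End measurability_cV.

Section matrix_norm.
Context {R : realType} {m n : nat}.

Lemma ler_coord_norm (A : 'M[R]_(m, n)) i j : `|A i j| <= `|A|.
Proof.
by rewrite [leRHS]mx_normrE (le_bigmax _ (fun k => `|A k.1 k.2|) (i, j)).
Qed.

End matrix_norm.

(** Links the unit sphere of row vectors, on which compactness is used, with the columns that [dot]
    takes. *)
Lemma norm_trmx {R : realType} {m n : nat} (A : 'M[R]_(m, n)) : `|A^T| = `|A|.
Proof.
suff le_tr m' n' (B : 'M[R]_(m', n')) : `|B^T| <= `|B|.
  by apply/eqP; rewrite eq_le le_tr -{1}(trmxK A) le_tr.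
have [->|B0] := eqVneq B^T 0; first by rewrite normr0.
have [i Bi] : exists i, `|B^T| = `|B^T i.1 i.2|.
  by apply: mx_norm_neq0; rewrite -[mx_norm _]/(`|B^T|) normr_eq0.
by rewrite Bi mxE ler_coord_norm.
Qed.

(** * Bounded rho-functions *)

Section bounded_rho_theory.
Context {R : realType}.
Variable rho : R -> R.
Hypotheses (rho_bounded : bounded_rho rho) (rho_C2 : twice_cont_diff rho)
  (rho_const : eventually_constant rho).

Lemma rho_ge0_le1 v : 0 <= rho v <= 1.
Proof. by case: rho_bounded. Qed.

Lemma rho_homo v v' : `|v| <= `|v'| -> rho v <= rho v'.
Proof. by case: rho_bounded => _ + _ _ _; exact. Qed.

Lemma rho_eq_norm v v' : `|v| = `|v'| -> rho v = rho v'.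
Proof. by move=> vv'; apply/eqP; rewrite eq_le !rho_homo// vv'. Qed.

Lemma rho0_eq0 : rho 0 = 0.
Proof. by case: rho_bounded. Qed.

Lemma rho_continuous : continuous rho.
Proof.
case: rho_C2 => drho _ _ v.
by apply: differentiable_continuous; apply/derivable1_diffP.
Qed.

Lemma measurable_rho : measurable_fun setT rho.
Proof. exact: continuous_measurable_fun rho_continuous. Qed.

Lemma rho_saturated : exists2 M : R, 0 < M & forall v, M <= `|v| -> rho v = 1.
Proof.
have [c [M rhoc]] := rho_const.
suff c1 : c = 1.
  exists (Num.max M 1); first by rewrite lt_max ltr01 orbT.
  by move=> v; rewrite ge_max => /andP[Mv _]; rewrite rhoc.
have [_ _ _ + _] := rho_bounded.
move=> /(cvg_lim (@Rhausdorff R)) <-; apply/esym/cvg_lim => //.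
apply: cvg_near_cst; near=> v; apply: rhoc.
by rewrite ger0_norm//; near: v; apply: nbhs_pinfty_ge; rewrite num_real.
Unshelve. all: by end_near. Qed.

(** [bounded_rho] gives strictness only between positive points with values below 1. A value 1 at
    [v'] is immediate, and v = 0 is reached through the point |v'| / 2. *)
Lemma rho_strict_homo v v' : rho v < 1 -> `|v| < `|v'| -> rho v < rho v'.
Proof.
move=> rv vv'.
have [rv'|rv'] := ltP (rho v') 1; last exact: lt_le_trans rv'.
have [_ _ _ _ sinc] := rho_bounded.
have pos a a' : 0 < a -> a < a' -> a' <= `|v'| -> rho a < rho a'.
  move=> a0 aa' a'v'; have a'0 : 0 < a' := lt_trans a0 aa'.
  have ra' : rho a' < 1.
    by apply: le_lt_trans rv'; apply: rho_homo; rewrite gtr0_norm.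
  apply: sinc => //; apply: le_lt_trans ra'; apply: rho_homo.
  by rewrite !gtr0_norm// ltW.
rewrite (@rho_eq_norm v' `|v'|) ?normr_id//.
have [v0|v0] := eqVneq v 0.
  rewrite v0 rho0_eq0.
  have v'0 : 0 < `|v'| by rewrite (le_lt_trans _ vv').
  apply: (@le_lt_trans _ _ (rho (`|v'| / 2))).
    by case/andP: (rho_ge0_le1 (`|v'| / 2)).
  by apply: pos; rewrite ?divr_gt0// ltr_pdivrMr//; lra.
by rewrite (@rho_eq_norm v `|v|) ?normr_id// pos// normr_gt0.
Qed.

(** Continuity keeps [rho] below 1 near the origin; this is the strictness that Anderson's
    inequality asks of the loss. *)
Lemma rho_strict_near0 (s : R) : 0 < s -> exists2 eta : R, 0 < eta &
  forall v v', `|v| < eta -> `|v| < `|v'| -> rho (v / s) < rho (v' / s).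
Proof.
move=> s0.
have /cvgrPdist_lt/(_ _ ltr01) : rho v @[v --> (0 : R)] --> rho 0.
  exact: rho_continuous.
rewrite rho0_eq0 => /nbhs_ballP[e /= e0 he].
exists (e * s); first exact: mulr_gt0.
move=> v v' ve vv'; apply: rho_strict_homo.
  have := he (v / s); rewrite /ball/= sub0r normrN normrM normfV (gtr0_norm s0).
  rewrite ltr_pdivrMr// => /(_ ve); rewrite sub0r normrN.
  exact/le_lt_trans/ler_norm.
by rewrite !normrM normfV (gtr0_norm s0) ltr_pM2r// invr_gt0.
Qed.

End bounded_rho_theory.

(** * Residuals in the compactified parametrization *)

Section homogeneous_residuals.
Context {R : realType} {p : nat}.
Implicit Types (a s delta : R) (theta : 'cV[R]_p) (z : borel_cV R p * R).

(* With h = theta / a the scaled residual (u - x'h) / s equals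
   (a u - x'theta) / (a s), where (a, theta) ranges over a compact set as h
   ranges over the complement of a ball. This is a lower bound of its absolute
   value that is uniform over the [delta]-neighbourhood of (a, theta, s). *)
Definition residual_lb a theta s delta z : R :=
  Num.max 0 (`|a * z.2 - dot z.1 theta| - delta * (norm1 z.1 + `|z.2|)) /
  ((a + delta) * (s + delta)).

(** The limit of the minorant as its neighbourhood shrinks. At a = 0 the quotient blows up where
    x'theta is non-zero, so the loss reaches 1; where x'theta = 0 only the trivial bound 0 is
    left. *)
Definition residual_limit (rho : R -> R) a theta s z : R :=
  if a == 0 then (dot z.1 theta != 0)%:R
  else rho ((z.2 - dot z.1 theta / a) / s).

Lemma measurable_residual_lb a theta s delta :
  measurable_fun setT (residual_lb a theta s delta).
Proof.
have mdot : measurable_fun setT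
    (fun z : borel_cV R p * R => dot z.1 theta).
  exact: (measurableT_comp (measurable_dot theta)).
have mnorm1 : measurable_fun setT (fun z : borel_cV R p * R => norm1 z.1).
  exact: (measurableT_comp measurable_norm1).
apply: measurable_funM => //; apply: measurable_maxr => //.
apply: measurable_funB.
  apply: measurableT_comp => //; apply: measurable_funB => //.
  exact: measurable_funM.
apply: measurable_funM => //; apply: measurable_funD => //.
exact: measurableT_comp.
Qed.

Lemma residual_lb_ge0 a theta s delta z : 0 <= a -> 0 <= s -> 0 <= delta ->
  0 <= residual_lb a theta s delta z.
Proof.
move=> a0 s0 d0; rewrite divr_ge0//; first by rewrite le_max lexx.
by rewrite mulr_ge0// addr_ge0.
Qed.

(** Moving (a, theta) by at most delta changes a u - x'theta by at most delta (norm1 x + |u|), and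
    the denominator stays below (a + delta)(s + delta). *)
Lemma residual_lb_le a a' theta theta' s delta e z :
  0 < a' -> 0 < s -> 0 <= e <= delta -> `|a - a'| <= delta ->
  (forall j, `|theta j 0 - theta' j 0| <= delta) ->
  residual_lb a theta s delta z <=
    `|(z.2 - dot z.1 (a'^-1 *: theta')) / (s + e)|.
Proof.
move=> a'0 s0 /andP[e0 ed] aa' tt'.
have -> : (z.2 - dot z.1 (a'^-1 *: theta')) / (s + e) =
    (a' * z.2 - dot z.1 theta') / (a' * (s + e)).
  rewrite dotZr; field; rewrite !gt_eqF//; lra.
have den0 : 0 < a' * (s + e) by rewrite mulr_gt0//; lra.
have den : a' * (s + e) <= (a + delta) * (s + delta).
  have : a' <= a + delta by move: aa'; rewrite ler_norml => /andP[? ?]; lra.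
  by move=> h; rewrite ler_pM//; lra.
rewrite normrM normfV (gtr0_norm den0) /residual_lb.
(* The truncation at 0 pays off here: denominators can be exchanged only under a non-negative
   numerator. *)
apply: (@le_trans _ _ (Num.max 0 (`|a * z.2 - dot z.1 theta| -
    delta * (norm1 z.1 + `|z.2|)) / (a' * (s + e)))).
  rewrite ler_wpM2l ?le_max ?lexx// lef_pV2// posrE//.
  exact: lt_le_trans den.
rewrite ler_pM2r ?invr_gt0// ge_max normr_ge0/=.
have h1 : `|(a - a') * z.2| <= delta * `|z.2| by rewrite normrM ler_wpM2r.
have h2 : `|dot z.1 (theta - theta')| <= norm1 z.1 * delta.
  by apply: ler_dot_norm1 => j; rewrite !mxE.
have -> : a * z.2 - dot z.1 theta =
    (a' * z.2 - dot z.1 theta') + ((a - a') * z.2 - dot z.1 (theta - theta')).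
  by rewrite dotBr; ring.
rewrite lerBlDr (le_trans (ler_normD _ _))// lerD2l.
rewrite (le_trans (ler_normB _ _))// mulrDr addrC lerD// mulrC//.
Qed.

(** For a > 0 this is continuity. For a = 0 it rests on saturation: the quotient tends to infinity
    when x'theta is non-zero, hence [rho] is eventually equal to 1, whereas x'theta = 0 makes the
    truncated numerator vanish. *)
Lemma cvg_rho_residual_lb rho a theta s z :
  bounded_rho rho -> twice_cont_diff rho -> eventually_constant rho ->
  0 <= a -> 0 < s ->
  rho (residual_lb a theta s k.+1%:R^-1 z) @[k --> \oo] -->
    residual_limit rho a theta s z.
Proof.
move=> hrho rhoC2 rhoE a0 s0.
have cdelta : (k.+1%:R^-1 : R) @[k --> \oo] --> (0 : R) by exact: cvg_harmonic.
have cnum : (Num.max 0 (`|a * z.2 - dot z.1 theta| -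
    k.+1%:R^-1 * (norm1 z.1 + `|z.2|)) : R) @[k --> \oo] -->
    (`|a * z.2 - dot z.1 theta| : R).
  rewrite [X in _ --> X](_ : _ = Num.max 0 (`|a * z.2 - dot z.1 theta| -
      0 * (norm1 z.1 + `|z.2|))); last first.
    by rewrite mul0r subr0 max_r.
  have maxE (v : R) : Num.max 0 v = (v + `|v|) * 2^-1.
    have [v0|v0] := leP 0 v.
      by rewrite ger0_norm//; field.
    by rewrite ltr0_norm// subrr mul0r.
  rewrite maxE; under eq_fun do rewrite maxE.
  have c1 : (`|a * z.2 - dot z.1 theta| -
      k.+1%:R^-1 * (norm1 z.1 + `|z.2|) : R) @[k --> \oo] -->
      (`|a * z.2 - dot z.1 theta| - 0 * (norm1 z.1 + `|z.2|) : R).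
    apply: cvgB; first exact: cvg_cst.
    by apply: cvgM => //; exact: cvg_cst.
  apply: cvgM; last exact: cvg_cst.
  by apply: cvgD; [exact: c1|exact: (cvg_norm c1)].
have cden : ((a + k.+1%:R^-1) * (s + k.+1%:R^-1) : R) @[k --> \oo] --> a * s.
  rewrite -{2}(addr0 a) -{2}(addr0 s).
  by apply: cvgM; apply: cvgD => //; exact: cvg_cst.
rewrite /residual_limit; case: eqVneq => [az|an0]; last first.
  have apos : 0 < a by rewrite lt_neqAle eq_sym an0.
  have -> : rho ((z.2 - dot z.1 theta / a) / s) =
      rho (`|a * z.2 - dot z.1 theta| / (a * s)).
    apply: (rho_eq_norm hrho).
    have -> : (z.2 - dot z.1 theta / a) / s =
        (a * z.2 - dot z.1 theta) / (a * s).
      by field; rewrite !gt_eqF.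
    by rewrite !normrM normr_id.
  have clb : residual_lb a theta s k.+1%:R^-1 z @[k --> \oo] -->
      `|a * z.2 - dot z.1 theta| / (a * s).
    apply: cvgM => //; apply: cvgV => //.
    by rewrite mulf_neq0// gt_eqF.
  exact: (cvg_comp _ _ clb (@rho_continuous _ rho rhoC2 _)).
rewrite az in cnum cden *; case: eqVneq => /= [d0|dn0].
  apply: cvg_near_cst; apply: nearW => k.
  rewrite /residual_lb d0 mul0r subr0 normr0 max_l ?mul0r ?rho0_eq0//.
  by rewrite sub0r oppr_le0 mulr_ge0// addr_ge0// norm1_ge0.
have [M M0 rhoM] := rho_saturated hrho rhoE.
have c0 : 0 < `|0 * z.2 - dot z.1 theta|.
  by rewrite mul0r sub0r normrN normr_gt0.
(* That the quotient exceeds M is read off without dividing: numerator minus M times denominator has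
   the positive limit |x'theta|. *)
have cdiff : (Num.max 0 (`|0 * z.2 - dot z.1 theta| -
    k.+1%:R^-1 * (norm1 z.1 + `|z.2|)) -
    M * ((0 + k.+1%:R^-1) * (s + k.+1%:R^-1)) : R) @[k --> \oo] -->
    (`|0 * z.2 - dot z.1 theta| - M * (0 * s)).
  apply: cvgB; first exact: cnum.
  by apply: cvgM; [exact: cvg_cst|exact: cden].
rewrite (mul0r s) mulr0 subr0 in cdiff.
apply: cvg_near_cst.
apply: filterS (cvgr_gt _ cdiff 0 c0) => k.
rewrite subr_gt0 => /ltW hk; apply: rhoM.
have k0 : 0 < (k.+1%:R^-1 : R) by rewrite invr_gt0.
have den0 : 0 < (0 + k.+1%:R^-1) * (s + k.+1%:R^-1).
  by rewrite add0r mulr_gt0// addr_gt0.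
rewrite ger0_norm; last by apply: residual_lb_ge0 => //; exact: ltW.
by rewrite /residual_lb ler_pdivlMr.
Qed.

Lemma measurable_residual_limit rho a theta s :
  bounded_rho rho -> twice_cont_diff rho -> eventually_constant rho ->
  0 <= a -> 0 < s -> measurable_fun setT (residual_limit rho a theta s).
Proof.
move=> hrho rhoC2 rhoE a0 s0.
apply: (measurable_fun_cvg (h := fun k z =>
  rho (residual_lb a theta s k.+1%:R^-1 z))) => [k|z _].
- by apply: measurableT_comp;
    [exact: measurable_rho|exact: measurable_residual_lb].
- exact: cvg_rho_residual_lb.
Qed.

End homogeneous_residuals.

(** * The lower bound uniform in h *)

Section uniform_lower_bound.
Context {R : realType} {p : nat} {d : measure_display} {T : measurableType d}.
Variable P : probability T R.
Variables (x : nat -> {RV P >-> borel_cV R p}) (u : nat -> {RV P >-> R}).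
Variable b : R.
Hypothesis strong_law : forall k : borel_cV R p * R -> R,
  measurable_fun setT k -> (forall z, 0 <= k z <= 1) ->
  {ae P, forall w, (n%:R^-1 * \sum_(i < n) k (x i w, u i w)) @[n --> \oo] -->
    \int[P]_w k (x 0%N w, u 0%N w)}.
Hypothesis indep : independent2 P (u 0%N) (x 0%N).
Hypothesis anderson : forall (g : R -> R) (c eta : R),
  measurable_fun setT g -> (forall v, 0 <= g v <= 1) ->
  (forall v v', `|v| <= `|v'| -> g v <= g v') ->
  0 < eta -> (forall v v', `|v| < eta -> `|v| < `|v'| -> g v < g v') ->
  c != 0 -> \int[P]_w g (u 0%N w) < \int[P]_w g (u 0%N w - c).
Hypothesis nondegenerate : forall beta : 'cV[R]_p, beta != 0 ->
  (P [set w | dot (x 0%N w) beta = 0%R] < (1 - b)%:E)%E.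

Variables (rho : R -> R) (s : R).
Hypotheses (rho_bounded : bounded_rho rho) (rho_C2 : twice_cont_diff rho)
  (rho_const : eventually_constant rho) (s_gt0 : 0 < s)
  (mean_le : \int[P]_w rho (u 0%N w / s) <= b).

Let m := \int[P]_w rho (u 0%N w / s).

Let mdot beta : measurable_fun setT (fun w => dot (x 0%N w) beta).
Proof. by apply: (measurableT_comp (measurable_dot beta)). Qed.

Let mrho_s : measurable_fun setT (fun v : R => rho (v / s)).
Proof.
apply: measurableT_comp; first exact: measurable_rho.
exact: measurable_funM.
Qed.

Let m01 : 0 <= m <= 1.
Proof.
apply: Rintegral_unit => [|w]; last exact: rho_ge0_le1.
exact: (measurableT_comp mrho_s).
Qed.

Let mdot0 beta : measurable [set w | dot (x 0%N w) beta = 0].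
Proof.
rewrite (_ : [set w | _] = (fun w => dot (x 0%N w) beta) @^-1` [set 0])//.
by rewrite -[X in measurable X]setTI; exact: mdot.
Qed.

Let prob_dot_neq0 beta : beta != 0 ->
  (b%:E < P (~` [set w | dot (x 0%N w) beta = 0%R]))%E.
Proof.
move=> beta0; rewrite probability_setC//.
have := nondegenerate beta0.
rewrite -[X in (X < _)%E -> _]fineK ?fin_num_measure// => h.
rewrite -[P _]fineK ?fin_num_measure//.
move: h; rewrite -EFinB !lte_fin; lra.
Qed.

(** For a > 0, Anderson's inequality is applied to u with x frozen and is strict when x'theta is
    non-zero. That event has probability above b >= m >= 0, so strictness survives the integration
    over x. *)
Lemma residual_limit_mean (a : R) (theta : 'cV[R]_p) :
  0 <= a -> theta != 0 ->
  m < \int[P]_w residual_limit rho a theta s (x 0%N w, u 0%N w).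
Proof.
move=> a0 theta0.
set A := [set w | dot (x 0%N w) theta = 0].
have mA : measurable (~` A) by apply: measurableC; exact: mdot0.
have := prob_dot_neq0 theta0; rewrite -/A => PA.
rewrite /residual_limit; case: eqVneq => [_|an0].
  apply: (le_lt_trans mean_le).
  rewrite -lte_fin; apply: (lt_le_trans PA).
  have -> : (fun w => (dot (x 0%N w) theta != 0)%:R) = (\1_(~` A) : T -> R).
    apply/funext => w; transitivity ((w \in ~` A)%:R : R) => //.
    by rewrite in_setC; congr ((~~ _)%:R); apply/eqP/idP; rewrite inE.
  rewrite EFin_Rintegral_unit; last 2 first.
  - exact: measurable_indic.
  - move=> w; suff : 0 <= ((w \in ~` A)%:R : R) <= 1 by [].
    by case: (_ \in _); rewrite ?lexx ?ler01.
  by have := integral_indic P measurableT mA; rewrite setIT => <-.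
have mf : measurable_fun setT (fun z : R * borel_cV R p =>
    rho ((z.1 - dot z.2 theta / a) / s)).
  apply: (measurableT_comp mrho_s); apply: measurable_funB => //.
  apply: measurable_funM => //.
  exact: (measurableT_comp (measurable_dot theta)).
have f01 (z : R * borel_cV R p) :
  0 <= rho ((z.1 - dot z.2 theta / a) / s) <= 1 by exact: rho_ge0_le1.
have := integral_independent2 indep mf f01 => /= ->.
have [eta eta0 strict] := rho_strict_near0 rho_bounded rho_C2 s_gt0.
have lt_m (c : R) : c != 0 -> m < \int[P]_v rho ((u 0%N v - c) / s).
  apply: (@anderson (fun v => rho (v / s)) c eta) => //.
  - by move=> v; exact: rho_ge0_le1.
  - move=> v v' vv'; apply: rho_homo => //.
    by rewrite !normrM ler_wpM2r.
rewrite -(Rintegral_cst_prob P m).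
apply: (@lt_Rintegral_unit _ _ _ P _ _ (~` A)) => //.
- apply: (measurableT_comp (measurable_Rintegral_unit (u 0%N) mf f01)) => //.
- move=> w; apply: Rintegral_unit; last by move=> v; exact: rho_ge0_le1.
  by apply: (measurableT_comp mrho_s); exact: measurable_funB.
- move=> w; have [c0|c0] := eqVneq (dot (x 0%N w) theta / a) 0.
    rewrite le_eqVlt; apply/orP; left; apply/eqP; apply: eq_Rintegral => v _ /=.
    by rewrite c0 subr0.
  exact/ltW/lt_m.
- apply: le_lt_trans PA; rewrite lee_fin.
  by apply: le_trans mean_le; case/andP: m01.
- move=> w /= Aw; apply: lt_m; rewrite mulf_neq0 ?invr_eq0//.
  exact/eqP.
Qed.

(** A single delta = 1/(k+1) is both the radius of the neighbourhood and the gain over [m]: the mean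
    of the minorant minus m + 1/(k+1) has a positive limit in k, so some k works. *)
Lemma local_lower_bound (a : R) (theta : 'cV[R]_p) : 0 <= a -> theta != 0 ->
  exists2 delta : R, 0 < delta & {ae P, forall w, \forall n \near \oo,
    m + delta <= n%:R^-1 *
      \sum_(i < n) rho (residual_lb a theta s delta (x i w, u i w))}.
Proof.
move=> a0 theta0.
have mk k : measurable_fun setT
    (fun z => rho (residual_lb a theta s k.+1%:R^-1 z)).
  by apply: measurableT_comp;
    [exact: measurable_rho|exact: measurable_residual_lb].
have mxu : measurable_fun setT (fun w => (x 0%N w, u 0%N w)).
  exact: measurable_fun_pair.
have cE : \int[P]_w rho (residual_lb a theta s k.+1%:R^-1 (x 0%N w, u 0%N w))
    @[k --> \oo] -->
    \int[P]_w residual_limit rho a theta s (x 0%N w, u 0%N w).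
  apply: bounded_convergence => [k||k w|w].
  - exact: (measurableT_comp (mk k) mxu).
  - by apply: (measurableT_comp _ mxu); exact: measurable_residual_limit.
  - exact: rho_ge0_le1.
  - exact: cvg_rho_residual_lb.
have cm : m + k.+1%:R^-1 @[k --> \oo] --> m.
  rewrite -[X in _ --> X]addr0; apply: cvgD; first exact: cvg_cst.
  exact: cvg_harmonic.
have := residual_limit_mean a0 theta0; rewrite -subr_gt0 => gap.
have := cvgr_gt _ (cvgB cE cm) 0 gap => -[k _ /(_ k (leqnn k))/=].
rewrite subr_gt0 => hk.
exists k.+1%:R^-1; first by rewrite invr_gt0.
have := strong_law (mk k) (fun z => rho_ge0_le1 rho_bounded _).
apply: filterS => w cw.
by apply: filterS (cvgr_gt _ cw _ hk) => n /ltW.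
Qed.

Lemma uniform_lower_bound (eps : R) : 0 < eps ->
  exists2 e : R, 0 < e & {ae P, forall w, \forall n \near \oo,
    forall h : 'cV[R]_p, eps <= `|h| -> m + e <= n%:R^-1 *
      \sum_(i < n) rho ((u i w - dot (x i w) h) / (s + e))}.
Proof.
move=> eps0.
pose I : Type := (R * T * nat)%type.
(* Compactness in its near-covering form, for this filter on (e, w, n), replaces
   the choice of a finite subcover. *)
pose F : set_system I := fun S => exists2 e0 : R, 0 < e0 &
  {ae P, forall w, \forall n \near \oo,
    forall e, 0 < e <= e0 -> S (e, w, n)}.
have FF : Filter F.
  split.
  - by exists 1 => //; apply: aeW => w; apply: nearW.
  - move=> A B [e1 e10 A1] [e2 e20 B2].
    exists (Num.min e1 e2); first by rewrite lt_min e10.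
    apply: filterS2 A1 B2 => w; apply: filterS2 => n hA hB e.
    by rewrite le_min => /and3P[e0 ee1 ee2]; split;
      [apply: hA|apply: hB]; rewrite e0.
  - move=> A B AB [e e0 hA]; exists e => //.
    apply: filterS hA => w; apply: filterS => n hA e' he'.
    exact/AB/hA.
pose K : set (R * 'rV[R]_p) :=
  `[0, eps^-1]%classic `*` [set theta : 'rV[R]_p | `|theta| = 1].
have cK : compact K.
  apply: compact_setX; first exact: segment_compact.
  apply: bounded_closed_compact.
    by exists 1; split => // M M1 v /= ->; exact: ltW.
  rewrite (_ : [set _ | _] = Num.norm @^-1` [set (1 : R)])//.
  apply: closed_comp; last exact: closed_eq.
  by move=> v _; exact: norm_continuous.
(* The premise makes the claim vacuous at the points at infinity: they are there for compactness,
   and what counts is the bound on their neighbourhoods. *)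
pose Pr (i : I) (y : R * 'rV[R]_p) := 0 < y.1 ->
  m + i.1.1 <= i.2%:R^-1 * \sum_(j < i.2)
    rho ((u j i.1.2 - dot (x j i.1.2) (y.1^-1 *: y.2^T)) / (s + i.1.1)).
have : \forall i \near F, K `<=` Pr i.
  move/compact_near_coveringP : cK; apply => // -[a theta] [/= a01 theta1].
  have a0 : 0 <= a by move: a01; rewrite in_itv/= => /andP[].
  have theta0 : theta^T != 0.
    rewrite trmx_eq0; apply/eqP => theta0.
    by move: theta1; rewrite theta0 normr0 => /esym/eqP; rewrite oner_eq0.
  have [delta delta0 hdelta] := local_lower_bound a0 theta0.
  exists (ball (a, theta) delta, [set i : I | i.1.1 <= delta /\ 0 < i.1.1 /\
    m + delta <= i.2%:R^-1 * \sum_(j < i.2)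
      rho (residual_lb a theta^T s delta (x j i.1.2, u j i.1.2))]).
    split; first exact: nbhsx_ballx.
    exists delta => //; apply: filterS hdelta => w; apply: filterS => n hn e.
    by case/andP.
  move=> [[a' theta'] [[e w] n]] [/= [aa' [_ tt']] [ed [e0 hn]]] /= a'0.
  apply: (@le_trans _ _ (m + delta)); first by rewrite lerD2l.
  apply: (le_trans hn); rewrite ler_wpM2l ?invr_ge0//.
  apply: ler_sum => j _; apply: rho_homo => //.
  rewrite ger0_norm; last by apply: residual_lb_ge0 => //; exact: ltW.
  apply: residual_lb_le => //.
  - by rewrite (ltW e0).
  - exact: ltW.
  - by move=> l; rewrite !mxE; exact/ltW/tt'.
move=> [e e0 he]; exists e => //.
apply: filterS he => w; apply: filterS => n /(_ e) hn h epsh.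
have h0 : 0 < `|h| by exact: lt_le_trans epsh.
have := hn _ (`|h|^-1, `|h|^-1 *: h^T).
rewrite e0 lexx => /(_ isT).
rewrite /Pr /= invr_gt0 h0 linearZ/= trmxK scalerA invrK.
rewrite mulfV ?gt_eqF// scale1r; apply => //.
split => /=.
  by rewrite in_itv/= invr_ge0 (ltW h0) lef_pV2.
by rewrite normrZ norm_trmx normfV normr_id mulVf// gt_eqF.
Qed.

End uniform_lower_bound.

(** * The M-estimate of scale *)

Section m_scale_theory.
Context {R : realType}.
Variables (rho : R -> R) (b : R).
Hypotheses (rho_bounded : bounded_rho rho) (rho_C2 : twice_cont_diff rho)
  (b_gt0 : 0 < b).

Lemma rho_div_homo (v s s' : R) : 0 < s -> s <= s' ->
  rho (v / s') <= rho (v / s).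
Proof.
move=> s0 ss'; have s'0 := lt_le_trans s0 ss'.
apply: rho_homo => //; rewrite !normrM !normfV (gtr0_norm s0) (gtr0_norm s'0).
rewrite ler_wpM2l//.
by rewrite lef_pV2.
Qed.

Lemma mean_rho_homo n (r : 'I_n -> R) (s s' : R) : 0 < s -> s <= s' ->
  n%:R^-1 * \sum_(i < n) rho (r i / s') <= n%:R^-1 * \sum_(i < n) rho (r i / s).
Proof.
move=> s0 ss'; rewrite ler_wpM2l ?invr_ge0//.
by apply: ler_sum => i _; exact: rho_div_homo.
Qed.

Let scales n (r : 'cV[R]_n) :=
  [set s : R | 0 < s /\ n%:R^-1 * \sum_(i < n) rho (r i 0 / s) <= b].

Let scales_has_lbound n (r : 'cV[R]_n) : has_lbound (scales r).
Proof. by exists 0 => s [s0 _]; exact: ltW. Qed.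

Let scales_neq0 n (r : 'cV[R]_n) : scales r !=set0.
Proof.
have /cvgrPdist_lt/(_ _ b_gt0) : rho v @[v --> (0 : R)] --> rho 0.
  exact: rho_continuous.
rewrite rho0_eq0// => /nbhs_ballP[e /= e0 he].
have S0 : 0 <= \sum_(i < n) `|r i 0| by exact: sumr_ge0.
(* Every |r i 0| / s is then below [e], so each loss is below [b]; the + 1 keeps [s] positive when
   all residuals vanish. *)
pose s := (\sum_(i < n) `|r i 0| + 1) / e.
have s0 : 0 < s by rewrite divr_gt0// ltr_wpDl.
exists s; split => //.
have [n0|n0] := posnP n.
  by rewrite big1 ?mulr0 ?ltW// => -[i ni] _; exfalso; move: ni; rewrite n0.
rewrite ler_pdivrMl ?ltr0n// mulr_natl -[in leRHS](card_ord n) -sumr_const.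
apply: ler_sum => i _.
have := he (r i 0 / s); rewrite /ball/= !sub0r !normrN.
rewrite normrM normfV (gtr0_norm s0).
rewrite ltr_pdivrMr// /s mulrCA mulfV ?gt_eqF// mulr1 => h.
apply: (le_trans (ler_norm _)); apply/ltW/h.
rewrite (bigD1 i)//= -addrA ltrDl ltr_wpDl//.
by apply: sumr_ge0.
Qed.

Lemma m_scale_ge0 n (r : 'cV[R]_n) : 0 <= m_scale rho b r.
Proof.
by apply: lb_le_inf; [exact: scales_neq0|move=> s [s0 _]; exact: ltW].
Qed.

Lemma m_scale_le n (r : 'cV[R]_n) (s : R) : 0 < s ->
  n%:R^-1 * \sum_(i < n) rho (r i 0 / s) <= b -> m_scale rho b r <= s.
Proof. by move=> s0 hs; apply: ge_inf => //; exact: (scales_has_lbound r). Qed.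

Lemma m_scale_ge n (r : 'cV[R]_n) (s : R) : 0 < s ->
  b < n%:R^-1 * \sum_(i < n) rho (r i 0 / s) -> s <= m_scale rho b r.
Proof.
move=> s0 hs; apply: lb_le_inf; first exact: scales_neq0.
move=> s' [s'0 hs'].
rewrite leNgt; apply/negP => ss'.
have := le_lt_trans hs' hs; rewrite ltNge => /negP; apply.
exact/mean_rho_homo/ltW.
Qed.

(** By monotonicity in the scale the admissible set is closed upwards, so everything strictly above
    its infimum is admissible. *)
Lemma mean_rho_le_of_m_scale n (r : 'cV[R]_n) (s : R) : m_scale rho b r < s ->
  n%:R^-1 * \sum_(i < n) rho (r i 0 / s) <= b.
Proof.
move=> /inf_lt -/(_ (scales_neq0 r)) [s' [s'0 hs'] ss'].
apply: le_trans hs'; exact/mean_rho_homo/ltW.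
Qed.

End m_scale_theory.

(** * Empirical means over a ball around the true parameter *)

Section perturbed_means.
Context {R : realType} {p : nat} {d : measure_display} {T : measurableType d}.
Variable P : probability T R.
Variables (x : nat -> {RV P >-> borel_cV R p}) (u : nat -> {RV P >-> R}).
Hypothesis strong_law : forall k : borel_cV R p * R -> R,
  measurable_fun setT k -> (forall z, 0 <= k z <= 1) ->
  {ae P, forall w, (n%:R^-1 * \sum_(i < n) k (x i w, u i w)) @[n --> \oo] -->
    \int[P]_w k (x 0%N w, u 0%N w)}.
Variable rho : R -> R.
Hypotheses (rho_bounded : bounded_rho rho) (rho_C2 : twice_cont_diff rho).

Let mean (s : R) := \int[P]_w rho (u 0%N w / s).

Let mrho (f : T -> R) (s : R) : measurable_fun setT f ->
  measurable_fun setT (fun w => rho (f w / s)).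
Proof.
move=> mf; apply: measurableT_comp; first exact: measurable_rho.
exact: measurable_funM.
Qed.

Lemma mean_rho_cvg (s_ : nat -> R) (s : R) : s != 0 ->
  s_ k @[k --> \oo] --> s -> mean (s_ k) @[k --> \oo] --> mean s.
Proof.
move=> s0 ss; apply: bounded_convergence => [k||k w|w].
- exact: mrho.
- exact: mrho.
- exact: rho_ge0_le1.
- have c : u 0%N w / s_ k @[k --> \oo] --> u 0%N w / s.
    by apply: cvgM; [exact: cvg_cst|exact: cvgV].
  exact: (cvg_comp _ _ c (@rho_continuous _ rho rho_C2 _)).
Qed.

Let perturbation_cvg (f_ : nat -> borel_cV R p * R -> R) (s : R) :
  (forall k, measurable_fun setT (f_ k)) ->
  (forall z, f_ k z @[k --> \oo] --> `|z.2|) ->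
  \int[P]_w rho (f_ k (x 0%N w, u 0%N w) / s) @[k --> \oo] --> mean s.
Proof.
move=> mf_ cf; apply: bounded_convergence => [k||k w|w].
- by apply: mrho; apply: (measurableT_comp (mf_ k)); exact: measurable_fun_pair.
- exact: mrho.
- exact: rho_ge0_le1.
- rewrite (@rho_eq_norm _ _ rho_bounded _ (`|u 0%N w| / s)); last first.
    by rewrite !normrM normr_id.
  have c : f_ k (x 0%N w, u 0%N w) / s @[k --> \oo] --> `|u 0%N w| / s.
    by apply: cvgM; [exact: cf|exact: cvg_cst].
  exact: (cvg_comp _ _ c (@rho_continuous _ rho rho_C2 _)).
Qed.

Let mnorm1 (delta : R) :
  measurable_fun setT (fun z : borel_cV R p * R => delta * norm1 z.1).
Proof.
apply: measurable_funM => //.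
exact: (measurableT_comp measurable_norm1).
Qed.

Let mabs : measurable_fun setT (fun z : borel_cV R p * R => `|z.2|).
Proof. exact: measurableT_comp. Qed.

Let cvg_delta_norm1 (z : borel_cV R p * R) :
  (k.+1%:R^-1 * norm1 z.1 : R) @[k --> \oo] --> (0 : R).
Proof.
rewrite -[X in _ --> X](mul0r (norm1 z.1)).
by apply: cvgM; [exact: cvg_harmonic|exact: cvg_cst].
Qed.

Let ler_dot_delta (v h : 'cV[R]_p) (delta : R) : `|h| <= delta ->
  `|dot v h| <= delta * norm1 v.
Proof.
move=> hd; rewrite mulrC; apply: ler_dot_norm1 => j.
exact: le_trans (ler_coord_norm _ _ _) hd.
Qed.

(** The majorant |u| + delta norm1 x serves all h in the ball at once, so one strong law covers even
    a random h. *)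
Lemma perturbed_mean_lt (s c : R) : 0 < s -> mean s < c ->
  exists2 delta : R, 0 < delta & {ae P, forall w, \forall n \near \oo,
    forall h : 'cV[R]_p, `|h| <= delta -> n%:R^-1 *
      \sum_(i < n) rho ((u i w - dot (x i w) h) / s) < c}.
Proof.
move=> s0 sc.
pose f_ k (z : borel_cV R p * R) := `|z.2| + k.+1%:R^-1 * norm1 z.1.
have mf_ k : measurable_fun setT (f_ k) by apply: measurable_funD.
have cf z : f_ k z @[k --> \oo] --> `|z.2|.
  rewrite -[X in _ --> X]addr0.
  by apply: cvgD; [exact: cvg_cst|exact: cvg_delta_norm1].
have [k _ /(_ k (leqnn k))/= hk] :=
  cvgr_lt _ (perturbation_cvg (s := s) mf_ cf) c sc.
exists k.+1%:R^-1; first by rewrite invr_gt0.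
have mk : measurable_fun setT (fun z => rho (f_ k z / s)).
  apply: measurableT_comp; first exact: measurable_rho.
  exact: measurable_funM.
have := strong_law mk (fun z => rho_ge0_le1 rho_bounded _).
apply: filterS => w cw.
apply: filterS (cvgr_lt _ cw _ hk) => n hn h hdelta.
apply: le_lt_trans hn; rewrite ler_wpM2l ?invr_ge0//.
apply: ler_sum => i _; apply: rho_homo => //.
rewrite !normrM ler_wpM2r// [leRHS]ger0_norm; last first.
  by rewrite addr_ge0// mulr_ge0// norm1_ge0.
by rewrite (le_trans (ler_normB _ _))// lerD2l ler_dot_delta.
Qed.

Lemma perturbed_mean_gt (s c : R) : 0 < s -> c < mean s ->
  exists2 delta : R, 0 < delta & {ae P, forall w, \forall n \near \oo,
    forall h : 'cV[R]_p, `|h| <= delta -> c < n%:R^-1 *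
      \sum_(i < n) rho ((u i w - dot (x i w) h) / s)}.
Proof.
move=> s0 sc.
pose g_ k (z : borel_cV R p * R) := `|z.2| - k.+1%:R^-1 * norm1 z.1.
(* The positive part: [rho] depends on absolute values, so a very negative [g_] would destroy the
   minorant. *)
pose f_ k (z : borel_cV R p * R) := (g_ k z + `|g_ k z|) / 2.
have mf_ k : measurable_fun setT (f_ k).
  have mg : measurable_fun setT (g_ k) by apply: measurable_funB.
  apply: measurable_funM => //; apply: measurable_funD => //.
  exact: measurableT_comp.
have cf z : f_ k z @[k --> \oo] --> `|z.2|.
  have -> : `|z.2| = (`|z.2| - 0 + `| `|z.2| - 0|) / 2.
    by rewrite subr0 normr_id; field.
  have cg : g_ k z @[k --> \oo] --> `|z.2| - 0.
    by apply: cvgB; [exact: cvg_cst|exact: cvg_delta_norm1].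
  apply: cvgM; last exact: cvg_cst.
  by apply: cvgD; [exact: cg|exact: (cvg_norm cg)].
have [k _ /(_ k (leqnn k))/= hk] :=
  cvgr_gt _ (perturbation_cvg (s := s) mf_ cf) c sc.
exists k.+1%:R^-1; first by rewrite invr_gt0.
have mk : measurable_fun setT (fun z => rho (f_ k z / s)).
  apply: measurableT_comp; first exact: measurable_rho.
  exact: measurable_funM.
have := strong_law mk (fun z => rho_ge0_le1 rho_bounded _).
apply: filterS => w cw.
apply: filterS (cvgr_gt _ cw _ hk) => n hn h hdelta.
apply: lt_le_trans hn _; rewrite ler_wpM2l ?invr_ge0//.
apply: ler_sum => i _; apply: rho_homo => //.
rewrite normrM [leRHS]normrM ler_wpM2r//.
have h1 : g_ k (x i w, u i w) <= `|u i w - dot (x i w) h|.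
  rewrite /g_ lerBlDr.
  apply: le_trans (lerD (lexx _) (ler_dot_delta (x i w) hdelta)).
  by rewrite -{1}[u i w : R](subrK (dot (x i w) h)) ler_normD.
rewrite /f_ normrM (@ger0_norm _ (2^-1 : R))// ler_pdivrMr//.
move: (g_ k (x i w, u i w)) `|u i w - dot (x i w) h| h1
  (normr_ge0 (u i w - dot (x i w) h)) => v v' vv' v'0.
have [v0|v0] := leP 0 v; last by rewrite (ltr0_norm v0) subrr normr0 mulr_ge0.
rewrite (ger0_norm v0) ger0_norm ?addr_ge0//; lra.
Qed.

End perturbed_means.

(** * The population scale s0 *)

Section population_scale.
Context {R : realType} {d : measure_display} {T : measurableType d}.
Variables (P : probability T R) (u : {RV P >-> R}) (rho : R -> R) (b : R).
Hypotheses (rho_bounded : bounded_rho rho) (rho_C2 : twice_cont_diff rho)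
  (rho_const : eventually_constant rho) (b01 : 0 < b < 1)
  (u_neq0 : {ae P, forall w, u w != 0}).

Let mean (s : R) := \int[P]_w rho (u w / s).

Let mrho (s : R) : measurable_fun setT (fun w => rho (u w / s)).
Proof.
apply: measurableT_comp; first exact: measurable_rho.
exact: measurable_funM.
Qed.

Let mean_homo (s s' : R) : 0 < s -> s <= s' -> mean s' <= mean s.
Proof.
move=> s0 ss'; apply: le_Rintegral_unit => // w; try exact: rho_ge0_le1.
exact: rho_div_homo.
Qed.

Let mean_cvg (s_ : nat -> R) (s : R) : s != 0 ->
  s_ k @[k --> \oo] --> s -> mean (s_ k) @[k --> \oo] --> mean s.
Proof.
move=> s0 ss; apply: bounded_convergence => // [k w|w].
  exact: rho_ge0_le1.
have c : u w / s_ k @[k --> \oo] --> u w / s.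
  by apply: cvgM; [exact: cvg_cst|exact: cvgV].
exact: (cvg_comp _ _ c (@rho_continuous _ rho rho_C2 _)).
Qed.

(** Equal means give rho(u / s') = rho(u / s) almost surely. Since u is non-zero, [rho] can fail to
    be strict only at the value 1, so [mean s'] would be 1. *)
Let mean_strict_homo (s s' : R) : 0 < s -> s < s' -> mean s' < 1 ->
  mean s' < mean s.
Proof.
move=> s0 ss' s'1; rewrite lt_neqAle mean_homo ?ltW// andbT.
apply/eqP => ss'E; move: s'1; suff -> : mean s' = 1 by rewrite ltxx.
rewrite -[RHS](Rintegral_cst_prob P 1); congr fine.
apply: ae_eq_integral => //.
  by apply/measurable_EFinP.
have s'0 := lt_trans s0 ss'.
have : {ae P, forall w, rho (u w / s') = rho (u w / s)}.
  have int a : P.-integrable setT (EFin \o (fun w => rho (u w / a))).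
    by apply: integrable_unit => // w; exact: rho_ge0_le1.
  apply: (ae_eq_Rintegral (int s') (int s) _ ss'E) => w.
  by apply: rho_div_homo => //; exact: ltW.
apply: filterS2 u_neq0 => w u0 uE _.
have /andP[_] := rho_ge0_le1 rho_bounded (u w / s').
rewrite le_eqVlt => /orP[/eqP->//|lt1].
have := @rho_strict_homo _ _ rho_bounded (u w / s') (u w / s) lt1.
rewrite uE ltxx !normrM !normfV (gtr0_norm s0) (gtr0_norm s'0).
by rewrite ltr_pM2l ?normr_gt0// ltf_pV2// => /(_ ss').
Qed.

Let mean_near0 : exists2 s : R, 0 < s & b < mean s.
Proof.
pose one w : R := (u w != 0)%:R.
have [M M0 rhoM] := rho_saturated rho_bounded rho_const.
have c w : rho (u w / k.+1%:R^-1) @[k --> \oo] --> one w.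
  rewrite /one; have [->|u0] := eqVneq (u w) 0.
    by apply: cvg_near_cst; apply: nearW => k; rewrite mul0r rho0_eq0.
  apply: cvg_near_cst.
  exists (Num.truncn (M / `|u w|)) => // k /= kM; apply: rhoM.
  rewrite invrK normrM normr_nat -ler_pdivrMl ?normr_gt0// mulrC.
  by rewrite (le_trans (ltW (truncnS_gt _)))// ler_nat.
have mone : measurable_fun setT one.
  apply: (measurable_fun_cvg (h := fun k w => rho (u w / k.+1%:R^-1)))
    => [k|w _].
    exact: mrho.
  exact: c.
have /cvgr_gt h : mean k.+1%:R^-1 @[k --> \oo] --> \int[P]_w one w.
  apply: bounded_convergence => // k w; exact: rho_ge0_le1.
have E1 : \int[P]_w one w = 1.
  rewrite -[RHS](Rintegral_cst_prob P 1); congr fine.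
  apply: ae_eq_integral => //; first exact/measurable_EFinP.
  by apply: filterS u_neq0 => w u0 _; rewrite /one u0.
have [|k _ /(_ k (leqnn k))/= hk] := h b.
  by rewrite E1; case/andP: b01.
by exists k.+1%:R^-1; rewrite // invr_gt0.
Qed.

Let mean_infty : exists2 s : R, 0 < s & mean s <= b.
Proof.
have /cvgr_lt h : mean k.+1%:R @[k --> \oo] --> \int[P]_w (0 : R).
  apply: bounded_convergence => // [k w|w]; first exact: rho_ge0_le1.
  rewrite -[X in _ --> X](rho0_eq0 rho_bounded).
  have c : u w / k.+1%:R @[k --> \oo] --> (0 : R).
    rewrite -[X in _ --> X](mulr0 (u w)).
    by apply: cvgM; [exact: cvg_cst|exact: cvg_harmonic].
  exact: (cvg_comp _ _ c (@rho_continuous _ rho rho_C2 _)).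
have [|k _ /(_ k (leqnn k))/= hk] := h b.
  by rewrite Rintegral_cst_prob; case/andP: b01.
by exists k.+1%:R; rewrite // ltW.
Qed.

(** The scale is the infimum of those with mean at most [b], and continuity from both sides gives
    equality. The strict inequalities on either side are what later traps the sample scale. *)
Lemma exists_population_scale : exists s : R,
  [/\ 0 < s, mean s = b, forall s', 0 < s' -> s' < s -> b < mean s' &
    forall s', s < s' -> mean s' < b].
Proof.
have [slow slow0 hlow] := mean_near0.
pose A := [set s : R | 0 < s /\ mean s <= b].
have A0 : A !=set0 by have [s s0 hs] := mean_infty; exists s.
have Alow : lbound A slow.
  move=> s [s0 hs]; rewrite leNgt; apply/negP => ss.
  have := le_lt_trans hs hlow.
  by rewrite ltNge mean_homo// ltW.
have hA : has_lbound A by exists slow.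
pose s := inf A.
have s0 : 0 < s by apply: (lt_le_trans slow0); exact: lb_le_inf.
have below s' : 0 < s' -> s' < s -> b < mean s'.
  move=> s'0 s's; rewrite ltNge; apply/negP => hs'.
  by have := ge_inf hA (conj s'0 hs'); rewrite leNgt s's.
have above_le s' : s < s' -> mean s' <= b.
  move=> ss'; have [a [a0 ha] as'] := inf_lt A0 ss'.
  by apply: le_trans ha; apply: mean_homo => //; exact: ltW.
have above s' : s < s' -> mean s' < b.
  (* The infimum yields only <= b above [s]; passing through an intermediate [a] makes it strict,
     since mean s' <= b < 1. *)
  move=> ss'; pose a := (s + s') / 2.
  have sa : s < a by rewrite /a ltr_pdivlMr//; lra.
  have as' : a < s' by rewrite /a ltr_pdivrMr//; lra.
  apply: lt_le_trans (above_le _ sa).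
  apply: mean_strict_homo => //; first exact: lt_trans sa.
  by apply: (le_lt_trans (above_le _ ss')); case/andP: b01.
exists s; split => //; apply/eqP; rewrite eq_le; apply/andP; split.
  have c : mean (s + k.+1%:R^-1) @[k --> \oo] --> mean s.
    apply: mean_cvg; first by rewrite gt_eqF.
    rewrite -[X in _ --> X]addr0.
    by apply: cvgD; [exact: cvg_cst|exact: cvg_harmonic].
  rewrite -(cvg_lim (@Rhausdorff R) c); apply: limr_le; first exact: cvgP c.
  by apply: nearW => k; apply: above_le; rewrite ltrDl invr_gt0.
have cs : s - k.+1%:R^-1 @[k --> \oo] --> s.
  rewrite -[X in _ --> X]subr0.
  by apply: cvgB; [exact: cvg_cst|exact: cvg_harmonic].
have c : mean (s - k.+1%:R^-1) @[k --> \oo] --> mean s.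
  by apply: mean_cvg => //; rewrite gt_eqF.
rewrite -(cvg_lim (@Rhausdorff R) c); apply: limr_ge; first exact: cvgP c.
apply: filterS (cvgr_gt _ cs _ s0) => k k0.
by apply/ltW/below => //; rewrite gtrBl invr_gt0.
Qed.

End population_scale.

(** * Consistency of the three estimators *)

Section consistency.
Context {R : realType} {p : nat} {d : measure_display} {T : measurableType d}.
Variable P : probability T R.
Variables (x : nat -> {RV P >-> borel_cV R p}) (u y : nat -> {RV P >-> R}).
Variable beta0 : 'cV[R]_p.
Hypothesis model : forall i w, y i w = dot (x i w) beta0 + u i w.
Hypothesis strong_law : forall k : borel_cV R p * R -> R,
  measurable_fun setT k -> (forall z, 0 <= k z <= 1) ->
  {ae P, forall w, (n%:R^-1 * \sum_(i < n) k (x i w, u i w)) @[n --> \oo] -->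
    \int[P]_w k (x 0%N w, u 0%N w)}.
Hypothesis indep : independent2 P (u 0%N) (x 0%N).
Hypothesis anderson : forall (g : R -> R) (c eta : R),
  measurable_fun setT g -> (forall v, 0 <= g v <= 1) ->
  (forall v v', `|v| <= `|v'| -> g v <= g v') ->
  0 < eta -> (forall v v', `|v| < eta -> `|v| < `|v'| -> g v < g v') ->
  c != 0 -> \int[P]_w g (u 0%N w) < \int[P]_w g (u 0%N w - c).
Variable b : R.
Hypothesis b01 : 0 < b < 1.
Hypothesis nondegenerate : forall beta : 'cV[R]_p, beta != 0 ->
  (P [set w | dot (x 0%N w) beta = 0%R] < (1 - b)%:E)%E.
Variables rho0 rho1 : R -> R.
Hypotheses (rho0_bounded : bounded_rho rho0) (rho0_C2 : twice_cont_diff rho0)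
  (rho0_const : eventually_constant rho0).
Hypotheses (rho1_bounded : bounded_rho rho1) (rho1_C2 : twice_cont_diff rho1)
  (rho1_const : eventually_constant rho1).
Hypothesis rho1_le_rho0 : forall v, rho1 v <= rho0 v.
Variable s0 : R.
Hypotheses (s0_gt0 : 0 < s0) (mean_s0 : \int[P]_w rho0 (u 0%N w / s0) = b)
  (mean_below : forall s, 0 < s -> s < s0 -> b < \int[P]_w rho0 (u 0%N w / s))
  (mean_above : forall s, s0 < s -> \int[P]_w rho0 (u 0%N w / s) < b).

Local Notation obs := (first_obs x y).

Lemma residuals_first_obs n w beta i :
  residuals (obs n w) beta i 0 = u i w - dot (x i w) (beta - beta0).
Proof. by rewrite mxE /= model dotBr; ring. Qed.

(** The null set may depend on eps; letting eps run over 1/(k+1) leaves countably many. *)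
Lemma consistent_of_near (est : estimator R p) :
  (forall eps : R, 0 < eps -> {ae P, forall w, \forall n \near \oo,
    `|est n (obs n w) - beta0| < eps}) ->
  strongly_consistent P x y est beta0.
Proof.
move=> near_est.
have : {ae P, forall w (k : nat), \forall n \near \oo,
    `|est n (obs n w) - beta0| < k.+1%:R^-1}.
  by apply: ae_foralln => k; apply: near_est; rewrite invr_gt0.
apply: filterS => w hw; apply/cvgrPdist_lt => eps eps0.
have [k _ /(_ k (leqnn k))/= hk] := cvgr_lt _ (@cvg_harmonic R) eps eps0.
apply: filterS (hw k) => n hn.
by rewrite distrC; exact: lt_trans hk.
Qed.

Lemma near_of_consistent (est : estimator R p) (delta : R) :
  strongly_consistent P x y est beta0 -> 0 < delta ->
  {ae P, forall w, \forall n \near \oo, `|est n (obs n w) - beta0| <= delta}.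
Proof.
move=> cest delta0; apply: filterS cest => w /cvgrPdist_lt/(_ _ delta0).
by apply: filterS => n; rewrite distrC => /ltW.
Qed.

(** The level [b] lies strictly between the means at [s2] and [s1], and this persists on a ball of
    perturbations that eventually contains est - beta0. *)
Lemma m_scale_near (est : estimator R p) (s1 s2 : R) :
  strongly_consistent P x y est beta0 -> 0 < s1 -> s1 < s0 -> s0 < s2 ->
  {ae P, forall w, \forall n \near \oo,
    s1 <= m_scale rho0 b (residuals (obs n w) (est n (obs n w))) <= s2}.
Proof.
move=> cest s10 s1s0 s0s2.
have s20 := lt_trans s0_gt0 s0s2.
have [d1 d10 h1] := perturbed_mean_gt strong_law rho0_bounded rho0_C2 s10
  (mean_below s10 s1s0).
have [d2 d20 h2] := perturbed_mean_lt strong_law rho0_bounded rho0_C2 s20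
  (mean_above s0s2).
have hle := near_of_consistent cest (_ : 0 < Num.min d1 d2).
rewrite lt_min d10 d20 in hle; have {}hle := hle isT.
apply: filterS3 h1 h2 hle => w; apply: filterS3 => n h1 h2.
rewrite le_min => /andP[he1 he2].
have b0 : 0 < b by case/andP: b01.
have rE s : n%:R^-1 * \sum_(i < n)
    rho0 (residuals (obs n w) (est n (obs n w)) i 0 / s) =
  n%:R^-1 * \sum_(i < n)
    rho0 ((u i w - dot (x i w) (est n (obs n w) - beta0)) / s).
  by congr (_ * _); apply: eq_bigr => i _; rewrite residuals_first_obs.
apply/andP; split.
  by apply: m_scale_ge => //; rewrite rE; exact: h1.
by apply: m_scale_le => //; rewrite rE; exact/ltW/h2.
Qed.

Lemma bridge_penalty_ge0 (ic : option 'I_p) (q : R) (beta : 'cV[R]_p) :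
  0 <= bridge_penalty ic q beta.
Proof. by apply: sumr_ge0 => j _; exact: powR_ge0. Qed.

Lemma strongly_consistent_cst :
  strongly_consistent P x y (fun _ _ => beta0) beta0.
Proof. by apply: aeW => w; exact: cvg_cst. Qed.

(** Comparison with beta0 puts the scale at the estimate below s0 + e. The mean loss at s0 + e is
    then at most b, against the lower bound b + e away from beta0. *)
Lemma s_bridge_consistent (ic : option 'I_p) (r : R) (gamma : nat -> R)
    (est : estimator R p) :
  (forall n, (0 < n)%N -> 0 < gamma n) ->
  (forall eps : R, 0 < eps -> \forall n \near \oo, gamma n <= eps * n%:R) ->
  (forall n w, (0 < n)%N ->
    argmin (s_bridge_obj ic rho0 b r (gamma n) (obs n w)) (est n (obs n w))) ->
  strongly_consistent P x y est beta0.
Proof.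
have [b0 _] := andP b01.
move=> gamma0 gammao est_min; apply: consistent_of_near => eps eps0.
have mean_le : \int[P]_w rho0 (u 0%N w / s0) <= b by rewrite mean_s0.
have [e e0 hlow] := uniform_lower_bound strong_law indep anderson nondegenerate
  rho0_bounded rho0_C2 rho0_const s0_gt0 mean_le eps0.
rewrite mean_s0 in hlow.
have s0e : s0 < s0 + e / 2 by rewrite ltrDl divr_gt0.
have s0half : s0 / 2 < s0 by rewrite ltr_pdivrMr// ltr_pMr// ltr1n.
(* Applied to the constant estimator beta0, this bounds the scale of the true errors by s0 + e /
   2. *)
have hscale := m_scale_near strongly_consistent_cst
  (divr_gt0 s0_gt0 (ltr0Sn _ 1)) s0half s0e.
apply: filterS2 hlow hscale => w {}hlow {}hscale.
set pen := bridge_penalty ic r beta0.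
have pen1 : 0 < pen + 1 by rewrite ltr_wpDl// bridge_penalty_ge0.
have e2 : 0 <= s0 + e / 2 by rewrite addr_ge0 ?divr_ge0// ltW.
have e1 : 0 <= s0 + e by rewrite addr_ge0// ltW.
have e21 : s0 + e / 2 < s0 + e by rewrite ltrD2l ltr_pdivrMr// ltr_pMr// ltr1n.
have gap : 0 < (s0 + e) ^+ 2 - (s0 + e / 2) ^+ 2.
  by rewrite subr_gt0 ltr_pXn2r ?nnegrE.
(* With this rate the penalty at beta0 stays strictly below n times [gap]; the + 1 in the divisor
   covers a zero penalty. *)
have hgamma := gammao _ (divr_gt0 gap pen1).
have n_gt0 : \forall n \near \oo, (0 < n)%N by exists 1%N.
apply: filterS3 hlow hscale (filterI hgamma n_gt0).
move=> n {}hlow /andP[_ {}hscale] [{}hgamma n0].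
rewrite ltNge; apply/negP => /hlow; apply/negP; rewrite -ltNge.
have nR : 0 < n%:R :> R by rewrite ltr0n.
set z := obs n w; set beta := est n z.
have hmin := est_min n w n0 beta0.
have sbeta : m_scale rho0 b (residuals z beta) < s0 + e.
  rewrite -(@ltr_pXn2r _ 2)// ?nnegrE ?m_scale_ge0//.
  have h1 : n%:R * m_scale rho0 b (residuals z beta) ^+ 2 <=
      n%:R * m_scale rho0 b (residuals z beta0) ^+ 2 + gamma n * pen.
    apply: le_trans hmin; rewrite lerDl mulr_ge0 ?bridge_penalty_ge0//.
    exact/ltW/gamma0.
  have h2 : m_scale rho0 b (residuals z beta0) ^+ 2 <= (s0 + e / 2) ^+ 2.
    by rewrite lerXn2r ?nnegrE ?m_scale_ge0//.
  have h3 : gamma n * pen < ((s0 + e) ^+ 2 - (s0 + e / 2) ^+ 2) * n%:R.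
    apply: (@lt_le_trans _ _ (gamma n * (pen + 1))).
      by rewrite ltr_pM2l ?ltrDl ?gamma0.
    by move: hgamma; rewrite mulrAC ler_pdivlMr.
  rewrite -(ltr_pM2l nR); apply: (le_lt_trans h1).
  have := ler_wpM2l (ltW nR) h2; move: h3; lra.
have := mean_rho_le_of_m_scale rho0_bounded rho0_C2 _ sbeta.
move=> /(_ b0) hb.
apply: le_lt_trans (_ : b < b + e); last by rewrite ltrDl.
apply: le_trans hb; rewrite le_eqVlt; apply/orP; left; apply/eqP.
by congr (_ * _); apply: eq_bigr => i _; rewrite residuals_first_obs.
Qed.

(** Both MM penalties enter only as an o(n) excess over the loss at beta0. The random scale is
    eventually in [s1, s0 + e], and monotonicity replaces it by s1 in the upper bound at beta0 and
    by s0 + e in the lower bound at the estimate. *)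
Lemma mm_consistent (est1 est : estimator R p) :
  strongly_consistent P x y est1 beta0 ->
  {ae P, forall w, exists2 c : nat -> R,
    (forall eps : R, 0 < eps -> \forall n \near \oo, c n <= eps * n%:R) &
    \forall n \near \oo,
      let z := obs n w in
      let s := m_scale rho0 b (residuals z (est1 n z)) in
      m_loss rho1 s z (est n z) <= m_loss rho1 s z beta0 + c n} ->
  strongly_consistent P x y est beta0.
Proof.
move=> cest1 hest; apply: consistent_of_near => eps eps0.
pose m1 := \int[P]_w rho1 (u 0%N w / s0).
(* Here [rho1_le_rho0] carries the calibration of s0 by [rho0] over to [rho1], as the points at
   infinity require. *)
have mean_le : m1 <= b.
  rewrite -mean_s0; apply: le_Rintegral_unit => [||w|w|w //].
  - apply: measurableT_comp; first exact: measurable_rho.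
    exact: measurable_funM.
  - apply: measurableT_comp; first exact: measurable_rho.
    exact: measurable_funM.
  - exact: rho_ge0_le1.
  - exact: rho_ge0_le1.
have [e e0 hlow] := uniform_lower_bound strong_law indep anderson nondegenerate
  rho1_bounded rho1_C2 rho1_const s0_gt0 mean_le eps0.
rewrite -/m1 in hlow.
(* Lowering the scale from s0 to s1 may use half of the margin [e]; the penalty gets the other
   half. *)
have [s1 [s10 s1s0 hs1]] : exists s1 : R,
    [/\ 0 < s1, s1 < s0 & \int[P]_w rho1 (u 0%N w / s1) < m1 + e / 2].
  have cs : s0 - k.+1%:R^-1 @[k --> \oo] --> s0.
    rewrite -[X in _ --> X]subr0.
    by apply: cvgB; [exact: cvg_cst|exact: cvg_harmonic].
  have c := @mean_rho_cvg _ _ _ P u rho1 rho1_bounded rho1_C2 _ _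
    (lt0r_neq0 s0_gt0) cs.
  have m1e : m1 < m1 + e / 2 by rewrite ltrDl divr_gt0.
  have [k _ /(_ k (leqnn k))[k1 k2]] :=
    filterI (cvgr_gt _ cs _ s0_gt0) (cvgr_lt _ c _ m1e).
  by exists (s0 - k.+1%:R^-1); split => //; rewrite gtrBl invr_gt0.
have [delta delta0 hup] :=
  perturbed_mean_lt strong_law rho1_bounded rho1_C2 s10 hs1.
have s0e : s0 < s0 + e by rewrite ltrDl.
have hscale := m_scale_near cest1 s10 s1s0 s0e.
apply: filterS3 hest hlow (filterI hup hscale).
move=> w [c c0 hloss] {}hlow [{}hup {}hscale].
have hc := c0 _ (divr_gt0 e0 (ltr0Sn _ 1)).
have n_gt0 : \forall n \near \oo, (0 < n)%N by exists 1%N.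
apply: filterS3 hlow (filterI hup hscale) (filterI (filterI hloss hc) n_gt0).
move=> n {}hlow [{}hup /andP[ss1 sse]] [[{}hloss hcn] n0].
rewrite ltNge; apply/negP => /hlow; apply/negP; rewrite -ltNge.
have nR : 0 < n%:R :> R by rewrite ltr0n.
move: hloss ss1 sse => /=.
set z := obs n w; set s := m_scale _ _ _ => hloss ss1 sse.
have spos : 0 < s by exact: lt_le_trans ss1.
have lossE beta : m_loss rho1 s z beta =
    \sum_(i < n) rho1 ((u i w - dot (x i w) (beta - beta0)) / s).
  by apply: eq_bigr => i _; rewrite residuals_first_obs.
have h1 : n%:R^-1 * m_loss rho1 s z beta0 < m1 + e / 2.
  have := hup 0; rewrite normr0 => /(_ (ltW delta0)); apply: le_lt_trans.
  rewrite lossE subrr; exact: (mean_rho_homo rho1_bounded _ s10 ss1).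
apply: (@le_lt_trans _ _ (n%:R^-1 * m_loss rho1 s z (est n z))).
  rewrite lossE; exact: (mean_rho_homo rho1_bounded _ spos sse).
have h2 : n%:R^-1 * c n <= e / 2 by rewrite ler_pdivrMl// mulrC.
have := ler_wpM2l (_ : 0 <= n%:R^-1) hloss.
rewrite invr_ge0 (ltW nR) mulrDr => /(_ isT); lra.
Qed.

Lemma mm_bridge_consistent (ic : option 'I_p) (q : R) (lambda : nat -> R)
    (est1 est : estimator R p) :
  strongly_consistent P x y est1 beta0 ->
  (forall n, (0 < n)%N -> 0 < lambda n) ->
  (forall eps : R, 0 < eps -> \forall n \near \oo, lambda n <= eps * n%:R) ->
  (forall n w, (0 < n)%N -> argmin (mm_bridge_obj ic rho0 rho1 b q (lambda n)
      (obs n w) (est1 n (obs n w))) (est n (obs n w))) ->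
  strongly_consistent P x y est beta0.
Proof.
move=> cest1 lambda0 lambdao est_min; apply: (mm_consistent cest1).
apply: aeW => w; set pen := bridge_penalty ic q beta0.
have pen0 : 0 <= pen by exact: bridge_penalty_ge0.
exists (fun n => lambda n * pen) => [eps eps0|].
  have pen1 : 0 < pen + 1 by rewrite ltr_wpDl.
  have n_gt0 : \forall n \near \oo, (0 < n)%N by exists 1%N.
  apply: filterS2 n_gt0 (lambdao _ (divr_gt0 eps0 pen1)) => n n0.
  rewrite mulrAC ler_pdivlMr//; apply: le_trans.
  by rewrite ler_pM2l ?lerDl ?lambda0.
exists 1%N => // n /= n0; apply: le_trans (est_min n w n0 beta0).
by rewrite lerDl mulr_ge0 ?bridge_penalty_ge0// ltW// lambda0.
Qed.

Lemma adaptive_term_ge0 (t vs w c : R) : (0 <= adaptive_term t vs w c)%E.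
Proof.
rewrite /adaptive_term; case: ifPn => _; first by case: ifPn.
by rewrite lee_fin divr_ge0// powR_ge0.
Qed.

(** A relative error of at most one half gives |w| >= |c| / 2, so the random weight has a
    deterministic bound. For c = 0 both sides vanish, as t > 0. *)
Lemma adaptive_term_le (t vs w c : R) : 0 < t -> 0 < vs ->
  `|w - c| <= `|c| / 2 ->
  (adaptive_term t vs w c <= (`|c| `^ t / (`|c| / 2) `^ vs)%:E)%E.
Proof.
move=> t0 vs0 wc; rewrite /adaptive_term.
have [c0|c0] := eqVneq c 0.
  rewrite c0 normr0 powR0 ?(gt_eqF t0)// !mul0r.
  by case: ifPn.
have cpos : 0 < `|c| by rewrite normr_gt0.
have cw : `|c| / 2 <= `|w|.
  have := lerB_dist c (c - w); rewrite subKr distrC => h.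
  apply: le_trans h; rewrite lerBrDr (le_trans (lerD (lexx _) wc))//.
  by rewrite -splitr.
have w0 : w != 0 by rewrite -normr_gt0 (lt_le_trans _ cw)// divr_gt0.
rewrite (negbTE w0) lee_fin ler_wpM2l ?powR_ge0//.
rewrite lef_pV2 ?posrE ?powR_gt0 ?divr_gt0 ?normr_gt0//.
by apply: ge0_ler_powR => //; rewrite ?nnegrE ?divr_ge0// ltW.
Qed.

Lemma adaptive_mm_bridge_consistent (ic : option 'I_p) (t vs : R)
    (iota : nat -> R) (est1 est2 est : estimator R p) :
  0 < t -> 0 < vs ->
  strongly_consistent P x y est1 beta0 ->
  strongly_consistent P x y est2 beta0 ->
  (forall n, (0 < n)%N -> 0 < iota n) ->
  (forall eps : R, 0 < eps -> \forall n \near \oo, iota n <= eps * n%:R) ->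
  (forall n w, (0 < n)%N -> argmin (adaptive_mm_bridge_obj ic rho0 rho1 b t vs
      (iota n) (obs n w) (est1 n (obs n w)) (est2 n (obs n w)))
    (est n (obs n w))) ->
  strongly_consistent P x y est beta0.
Proof.
move=> t0 vs0 cest1 cest2 iota0 iotao est_min; apply: (mm_consistent cest1).
pose C := \sum_(j < p | Some j != ic)
  `|beta0 j 0| `^ t / (`|beta0 j 0| / 2) `^ vs.
have C0 : 0 <= C by apply: sumr_ge0 => j _; rewrite divr_ge0// powR_ge0.
have C1 : 0 < C + 1 by rewrite ltr_wpDl.
apply: filterS cest2 => w cest2.
exists (fun n => iota n * C) => [eps eps0|].
  have n_gt0 : \forall n \near \oo, (0 < n)%N by exists 1%N.
  apply: filterS2 n_gt0 (iotao _ (divr_gt0 eps0 C1)) => n n0.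
  rewrite mulrAC ler_pdivlMr//; apply: le_trans.
  by rewrite ler_pM2l ?lerDl ?iota0.
(* Relative accuracy cannot be asked of a zero coordinate of beta0, but there the term at beta0 is 0
   for every weight. *)
have hpen : \forall n \near \oo, forall j,
    `|est2 n (obs n w) j 0 - beta0 j 0| <= `|beta0 j 0| / 2 \/ beta0 j 0 = 0.
  apply: filter_forall => j.
  have [bj0|bj0] := eqVneq (beta0 j 0) 0; first by apply: nearW => n; right.
  have pos : 0 < `|beta0 j 0| / 2 by rewrite divr_gt0// normr_gt0.
  move/cvgrPdist_le : cest2 => /(_ _ pos).
  apply: filterS => n hn; left; rewrite distrC; apply: le_trans hn.
  by have := ler_coord_norm (beta0 - est2 n (obs n w)) j 0; rewrite !mxE.
have n_gt0 : \forall n \near \oo, (0 < n)%N by exists 1%N.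
apply: filterS2 n_gt0 hpen => n n0 hpen /=.
have := est_min n w n0 beta0; rewrite /adaptive_mm_bridge_obj.
set s := m_scale _ _ _; set b2 := est2 _ _; set beta := est _ _ => hmin.
have penle : (adaptive_penalty ic t vs b2 beta0 <= C%:E)%E.
  rewrite /C -sumEFin; apply: lee_sum => j _.
  case: (hpen j) => [hj|->]; first exact: adaptive_term_le.
  rewrite /adaptive_term eqxx normr0 powR0 ?(gt_eqF t0)// !mul0r.
  by case: ifPn.
have pen0 : (0 <= adaptive_penalty ic t vs b2 beta)%E.
  by apply: sume_ge0 => j _; exact: adaptive_term_ge0.
(* The comparison stays in the extended reals: the penalty at the estimate is only known to be
   non-negative, while the one at beta0 is at most [C]. *)
rewrite -lee_fin EFinD EFinM; apply: (@le_trans _ _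
  ((m_loss rho1 s (obs n w) beta)%:E +
    (iota n)%:E * adaptive_penalty ic t vs b2 beta)%E).
  by rewrite leeDl// mule_ge0// lee_fin ltW// iota0.
apply: (le_trans hmin); rewrite leeD2l// lee_wpmul2l// lee_fin ltW//.
exact: iota0.
Qed.

End consistency.

(** * From the regression model to the hypotheses of the consistency arguments *)

Theorem theorem3 (R : realType) (p : nat)
    (d : measure_display) (T : measurableType d) (P : probability T R)
    (* the model *)
    (beta0 : 'cV[R]_p)
    (x : nat -> {RV P >-> borel_cV R p}) (u y : nat -> {RV P >-> R})
    (G0 : probability (borel_cV R p) R)
    (F0 : probability R R)
    (h_model : forall i w, y i w = dot (x i w) beta0 + u i w)
    (h_iid : iid P (fun i w => (x i w, y i w)))
    (h_G0 : forall i, has_law P (x i) G0)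
    (h_F0 : forall i, has_law P (u i) F0)
    (h_indep : forall i, independent2 P (u i) (x i))
    (ic : option 'I_p)
    (h_ic : forall j, ic = Some j ->
       G0 [set v : 'cV[R]_p | v j 0 = 1] = 1%E)
    (* the loss functions *)
    (rho0 rho1 : R -> R) (b : R)
    (h_rho0 : bounded_rho rho0) (h_rho1 : bounded_rho rho1)
    (h_rho_le : forall v, rho1 v <= rho0 v)
    (h_b : 0 < b < 1)
    (* B1 *)
    (h_B1_rho0 : twice_cont_diff rho0 /\ eventually_constant rho0)
    (h_B1_rho1 : twice_cont_diff rho1 /\ eventually_constant rho1)
    (* B2 *)
    (h_B2 : forall beta : 'cV[R]_p, beta != 0 ->
       (G0 [set v : 'cV[R]_p | dot v beta = 0%R] < (1 - b)%:E)%E)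
    (* B3 *)
    (f0 : R -> R)
    (h_f0 : has_density F0 f0)
    (h_f0_even : forall v, f0 (- v) = f0 v)
    (h_f0_cont : continuous f0)
    (h_f0_dec : forall v v', `|v| <= `|v'| -> f0 v' <= f0 v)
    (h_f0_sdec : exists2 delta : R, 0 < delta &
       forall v v', `|v| < `|v'| -> `|v'| < delta -> f0 v' < f0 v)
    (* tuning constants *)
    (r q t vs : R)
    (h_r : 0 < r) (h_q : 0 < q) (h_t : 0 < t) (h_vs : 0 < vs)
    (gamma lambda iota : nat -> R)
    (h_gamma : forall n, (0 < n)%N -> 0 < gamma n)
    (h_lambda : forall n, (0 < n)%N -> 0 < lambda n)
    (h_iota : forall n, (0 < n)%N -> 0 < iota n)
    (* estimators *)
    (est1 est2 estPS estB estA : estimator R p)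
    (h_est1 : strongly_consistent P x y est1 beta0)
    (h_est2 : strongly_consistent P x y est2 beta0)
    (h_estPS : forall n w, (0 < n)%N -> let z := first_obs x y n w in
       argmin (s_bridge_obj ic rho0 b r (gamma n) z) (estPS n z))
    (h_estB : forall n w, (0 < n)%N -> let z := first_obs x y n w in
       argmin (mm_bridge_obj ic rho0 rho1 b q (lambda n) z (est1 n z))
         (estB n z))
    (h_estA : forall n w, (0 < n)%N -> let z := first_obs x y n w in
       argmin (adaptive_mm_bridge_obj ic rho0 rho1 b t vs (iota n) z
                 (est1 n z) (est2 n z))
         (estA n z)) :
  [/\ gamma =o_\oo (fun n => n%:R : R) -> strongly_consistent P x y estPS beta0,
      lambda =o_\oo (fun n => n%:R : R) -> strongly_consistent P x y estB beta0 &
      iota =o_\oo (fun n => n%:R : R) -> strongly_consistent P x y estA beta0].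
Proof.
have mobs i : measurable_fun setT (fun w => (x i w, y i w)).
  exact: measurable_fun_pair.
pose Z i : {RV P >-> (borel_cV R p * R)%type} :=
  HB.pack (fun w => (x i w, y i w)) (isMeasurableFun.Build _ _ _ _ _ (mobs i)).
have strong_law (k : borel_cV R p * R -> R) : measurable_fun setT k ->
    (forall z, 0 <= k z <= 1) ->
    {ae P, forall w, (n%:R^-1 * \sum_(i < n) k (x i w, u i w)) @[n --> \oo] -->
      \int[P]_w k (x 0%N w, u 0%N w)}.
  move=> mk k01.
  (* The i.i.d. hypothesis concerns (x, y); as u = y - x'beta0, every function of (x, u) is one of
     (x, y). *)
  pose k' (z : borel_cV R p * R) := k (z.1, z.2 - dot z.1 beta0).
  have mk' : measurable_fun setT k'.
    apply: (measurableT_comp mk); apply: measurable_fun_pair => //.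
    apply: measurable_funB => //.
    exact: (measurableT_comp (measurable_dot beta0)).
  have k'E i w : k' (Z i w) = k (x i w, u i w).
    by rewrite /k' /= h_model addrC addKr.
  have := @strong_law_iid _ _ _ P _ _ Z k' h_iid mk' (fun z => k01 _).
  apply: filterS => w.
  have -> : \int[P]_v k' (Z 0%N v) = \int[P]_v k (x 0%N v, u 0%N v).
    by apply: eq_Rintegral => v _; exact: k'E.
  rewrite (_ : (fun n => _) =
    (fun n => n%:R^-1 * \sum_(i < n) k (x i w, u i w)))//.
  by apply/funext => n; congr (_ * _); apply: eq_bigr => i _; exact: k'E.
have mu0 : measurable_fun setT (u 0%N) by [].
pose U : {RV P >-> measurableTypeR R} :=
  HB.pack (u 0%N : T -> measurableTypeR R)
    (isMeasurableFun.Build _ _ T (measurableTypeR R) (u 0%N) mu0).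
have dens : lebesgue_density (distribution P U) f0.
  split; first exact: h_f0.1.
  by move=> A mA; rewrite -h_f0.2// -(h_F0 0%N).
have mf0 : measurable_fun setT f0 by exact: continuous_measurable_fun.
have U_mean (g : R -> R) : measurable_fun setT g -> (forall v, 0 <= g v <= 1) ->
    \int[distribution P U]_v g v = \int[P]_w g (u 0%N w).
  move=> mg g01; congr fine; rewrite ge0_integral_distribution//.
    exact/measurable_EFinP.
  by move=> v; rewrite lee_fin; case/andP: (g01 v).
have [delta delta0 f0_sdec] := h_f0_sdec.
have anderson (g : R -> R) (c eta : R) :
    measurable_fun setT g -> (forall v, 0 <= g v <= 1) ->
    (forall v v', `|v| <= `|v'| -> g v <= g v') ->
    0 < eta -> (forall v v', `|v| < eta -> `|v| < `|v'| -> g v < g v') ->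
    c != 0 -> \int[P]_w g (u 0%N w) < \int[P]_w g (u 0%N w - c).
  move=> mg g01 ginc eta0 gsinc c0.
  have mgc : measurable_fun setT (fun v : R => g (v - c)).
    by apply: (measurableT_comp mg); apply: measurable_funB.
  rewrite -U_mean// -(U_mean (fun v => g (v - c)))//.
  exact: (anderson_strict dens mf0 h_f0_even h_f0_dec delta0 f0_sdec mg g01 ginc
    eta0 gsinc c0).
(* A law with a density has no atom at 0; the existence of s0 depends on this. *)
have u_neq0 : {ae P, forall w, u 0%N w != 0}.
  exists (u 0%N @^-1` [set 0]); split.
  - rewrite -[X in measurable X]setTI.
    exact: (mu0 measurableT _ (measurable_set1 0)).
  - rewrite h_F0// h_f0.2//.
    by rewrite integral_set1.
  - by move=> w /= /negP; rewrite negbK => /eqP.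
have nondegenerate (beta : 'cV[R]_p) : beta != 0 ->
    (P [set w | dot (x 0%N w) beta = 0%R] < (1 - b)%:E)%E.
  move=> beta0'; have := h_B2 beta beta0'; rewrite -(h_G0 0%N)//.
  rewrite (_ : [set v | _] = (fun v => dot v beta) @^-1` [set 0])//.
  by rewrite -[X in measurable X]setTI; exact: measurable_dot.
have [s0 [s0_gt0 mean_s0 below above]] :=
  @exists_population_scale _ _ _ P (u 0%N) rho0 b h_rho0 h_B1_rho0.1
    h_B1_rho0.2 h_b u_neq0.
have little_o (f : nat -> R) : (forall n, (0 < n)%N -> 0 < f n) ->
    f =o_\oo (fun n => n%:R : R) ->
    forall eps : R, 0 < eps -> \forall n \near \oo, f n <= eps * n%:R.
  move=> _ /eqoP fo eps eps0; apply: filterS (fo eps eps0) => n.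
  by rewrite normr_nat; apply: le_trans; exact: ler_norm.
split => o.
- exact: (s_bridge_consistent h_model strong_law (h_indep 0%N) anderson h_b
    nondegenerate h_rho0 h_B1_rho0.1 h_B1_rho0.2 s0_gt0 mean_s0 below above
    h_gamma (little_o _ h_gamma o) h_estPS).
- exact: (mm_bridge_consistent h_model strong_law (h_indep 0%N) anderson h_b
    nondegenerate h_rho0 h_B1_rho0.1 h_rho1 h_B1_rho1.1 h_B1_rho1.2 h_rho_le
    s0_gt0 mean_s0 below above h_est1 h_lambda (little_o _ h_lambda o) h_estB).
- exact: (adaptive_mm_bridge_consistent h_model strong_law (h_indep 0%N)
    anderson h_b nondegenerate h_rho0 h_B1_rho0.1 h_rho1 h_B1_rho1.1
    h_B1_rho1.2 h_rho_le
    s0_gt0 mean_s0 below above h_t h_vs h_est1 h_est2 h_iota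
    (little_o _ h_iota o) h_estA).
Qed.
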